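(* Let $\mathbb{P}_{\mathbf{\Sigma}}$ be the proper smooth two-dimensional toric Deligne–Mumford stack associated to a complete stacky fan $\mathbf{\Sigma}=(\Sigma,\{v_i\}_{i=1}^n)$ in $N\cong\mathbb{Z}^2$. For a positive integer $m$ let $$\Lambda_m=\{\mathcal{L}\in\mathrm{Pic}(\mathbb{P}_{\mathbf{\Sigma}})\mid \dim\mathrm{H}^0(\mathbb{P}_{\mathbf{\Sigma}},\mathcal{L})+\dim\mathrm{H}^1(\mathbb{P}_{\mathbf{\Sigma}},\mathcal{L})+\dim\mathrm{H}^2(\mathbb{P}_{\mathbf{\Sigma}},\mathcal{L})<m\}.$$ If no two $v_i$ and $v_j$ with $i\neq j$ are collinear, then $\Lambda_m$ is finite for every positive integer $m$.
   Context: Setting: $N\cong\mathbb{Z}^2$ is a lattice, $N^*=\mathrm{Hom}(N,\mathbb{Z})$, and $\Sigma$ is a complete simplicial fan in $N$ with $n$ one-dimensional cones. A stacky fan $\mathbf{\Sigma}=(\Sigma,\{v_i\}_{i=1}^n)$ consists of $\Sigma$ together with a choice of a nonzero lattice point $v_i\in N$ (not necessarily primitive) in each one-dimensional cone of $\Sigma$. Two vectors $v_i,v_j$ with $i\neq j$ are collinear if they lie on a common line through the origin; since they span distinct rays this means $v_j=-c\,v_i$ for some $c>0$. The stack: let $G=\{(\zeta_1,\dots,\zeta_n)\in(\mathbb{C}^* )^n \mid \prod_{i=1}^n\zeta_i^{w\cdot v_i}=1\text{ for all } w\in N^*\}$, and let $U\subset\mathbb{C}^n$ be the open set of points $(x_1,\dots,x_n)$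 such that some cone of $\Sigma$ contains all $v_i$ with $x_i=0$. $G$ acts on $U$ coordinatewise, and $\mathbb{P}_{\mathbf{\Sigma}}=[U/G]$. Line bundles: for $(r_1,\dots,r_n)\in\mathbb{Z}^n$, $\mathcal{O}(\sum_i r_iE_i)$ is the line bundle on $\mathbb{P}_{\mathbf{\Sigma}}$ given by the trivial line bundle $\mathbb{C}\times U\to U$ with $G$-linearization $((\zeta_i),t,(x_i))\mapsto(t\prod_i\zeta_i^{r_i},(\zeta_ix_i))$. All line bundles arise this way, and $\mathrm{Pic}(\mathbb{P}_{\mathbf{\Sigma}})$ is the quotient of $\mathbb{Z}^n$ (basis $E_1,\dots,E_n$) by the subgroup of elements $\sum_i (w\cdot v_i)E_i$, $w\in N^*$. *)

(* Defs.v *)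
From mathcomp Require Import all_boot all_order all_algebra.
From mathcomp Require Import boolp classical_sets functions cardinality reals.
From mathcomp Require Import complex.
From mathcomp Require mpoly.

Set Implicit Arguments.
Unset Strict Implicit.
Unset Printing Implicit Defensive.

Import Order.TTheory GRing.Theory Num.Theory.

Local Open Scope classical_set_scope.
Local Open Scope ring_scope.

(* The lattice is N = Z^2, with N_R = R^2 and N^* = {additive N -> int}. *)
Notation lattice := 'rV[int]_2.

Section Fans.
Variable R : realType.
Local Notation plane := 'rV[R]_2.

Definition real_vec (u : lattice) : plane := map_mx intr u.

Definition cone_over k (u : 'I_k -> lattice) : set plane :=
  [set x | exists t : 'I_k -> R,
     (forall j, 0 <= t j) /\ x = \sum_j t j *: real_vec (u j)].

Definition ray_over (u : lattice) : set plane := cone_over (fun _ : 'I_1 => u).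

Definition rational_polyhedral (s : set plane) :=
  exists k (u : 'I_k -> lattice), s = cone_over u.

Definition strongly_convex (s : set plane) :=
  forall x, s x -> s (- x) -> x = 0.

(* t is the intersection of s with a supporting hyperplane (s itself for the
   zero functional). *)
Definition is_face (t s : set plane) :=
  exists l : 'cV[R]_2,
    (forall x, s x -> 0 <= (x *m l) 0 0) /\
    t = [set x | s x /\ (x *m l) 0 0 = 0].

Definition simplicial_cone (s : set plane) :=
  exists k (u : 'I_k -> lattice),
    row_free (\matrix_(j < k) real_vec (u j)) /\ s = cone_over u.

Definition is_fan (Sigma : set (set plane)) :=
  [/\ finite_set Sigma,
      forall s, Sigma s -> rational_polyhedral s /\ strongly_convex s,
      forall s t, Sigma s -> is_face t s -> Sigma t &
      forall s t, Sigma s -> Sigma t ->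
        is_face (s `&` t) s /\ is_face (s `&` t) t].

Definition simplicial_fan (Sigma : set (set plane)) :=
  forall s, Sigma s -> simplicial_cone s.

Definition complete_fan (Sigma : set (set plane)) :=
  forall x : plane, exists2 s, Sigma s & s x.

Definition fan_rays (Sigma : set (set plane)) : set (set plane) :=
  [set s | Sigma s /\ exists2 u : lattice, u != 0 & s = ray_over u].

Definition collinear (u u' : lattice) :=
  exists e : plane, e != 0 /\
    exists a b : R, real_vec u = a *: e /\ real_vec u' = b *: e.

End Fans.

(* For a nonzero lattice point u, the ray containing u is ray_over u; so a
   choice of a nonzero lattice point in each of the n one-dimensional cones is a
   family of nonzero v_i such that i |-> ray_over v_i enumerates these cones. *)
Record stacky_fan (R : realType) (n : nat) := StackyFan {
  cones : set (set 'rV[R]_2);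
  vec : 'I_n -> lattice;
  cones_fan : is_fan cones;
  cones_simplicial : simplicial_fan cones;
  cones_complete : complete_fan cones;
  vec_neq0 : forall i, vec i != 0;
  vec_rays : set_bij [set: 'I_n] (fan_rays cones)
               (fun i => ray_over (vec i))
}.

(* dim_quotient Z B d: the quotient of the subspace Z by the subspace B has
   finite dimension d. *)
Definition dim_quotient (K : fieldType) (V : lmodType K) (Z B : set V)
    (d : nat) :=
  exists z : 'I_d -> V,
    [/\ forall j, Z (z j),
        forall c : 'I_d -> K, B (\sum_j c j *: z j) -> forall j, c j = 0 &
        forall y, Z y -> exists c : 'I_d -> K, B (y - \sum_j c j *: z j)].

Section Stack.
Variables (R : realType) (n : nat) (S : stacky_fan R n).
Local Notation C := R[i].
Local Notation point := 'rV[C]_n.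
Local Notation func := (point -> C^o).
Local Notation v := (vec S).

Definition stack_group : set point :=
  [set z | (forall i, z 0 i != 0) /\
     forall w : {additive lattice -> int}, \prod_i z 0 i ^ w (v i) = 1].

Definition cox_open : set point :=
  [set x | exists2 s, cones S s &
     forall i, x 0 i = 0 -> s (real_vec R (v i))].

Definition act (z x : point) : point := \row_i (z 0 i * x 0 i).

Definition outside (s : set 'rV[R]_2) : {set 'I_n} :=
  [set i | real_vec R (v i) \notin s]%SET.

(* The complement in C^n of the coordinate hyperplanes indexed by J. *)
Definition principal_open (J : {set 'I_n}) : set point :=
  [set x | forall i, i \in J -> x 0 i != 0].

Lemma cox_open_cover :
  cox_open = \bigcup_(s in cones S) principal_open (outside s).
Proof.
apply/seteqP; split=> x /= [s Ss xs]; exists s => // i.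
  by rewrite inE => /negP ns; apply/eqP => /xs si; apply/ns/mem_set.
move=> xi0; apply: contrapT => si; have := xs i; rewrite inE xi0 eqxx.
by rewrite memNset // => /(_ isT).
Qed.

(* Regular functions on the affine variety D(h), h = \prod_(i in J) x_i: its
   coordinate ring is the localization of C[x_1, ..., x_n] at h. *)
Definition regular (J : {set 'I_n}) (f : func) :=
  exists (P : mpoly.mpoly n C) (k : nat), forall x, principal_open J x ->
    f x * (\prod_(i in J) x 0 i) ^+ k = mpoly.meval (fun i => x 0 i) P.

(* Sections of O(\sum_i r_i E_i) over the open substack [principal_open J / G]:
   these are the regular functions f such that x |-> (f x, x) is equivariant for
   the given linearization.  A function on principal_open J is represented by
   its extension by zero. *)
Definition sections (r : 'rV[int]_n) (J : {set 'I_n}) : set func :=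
  [set f | [/\ regular J f,
     forall z x, stack_group z -> principal_open J x ->
       f (act z x) = f x * \prod_i z 0 i ^ r 0 i &
     forall x, ~ principal_open J x -> f x = 0]].

(* The substacks [principal_open (outside s) / G], for s in the fan, cover
   [U / G] (cox_open_cover).  Each finite intersection of them is the quotient
   of an affine variety by the linearly reductive group G, so has no higher
   coherent cohomology; hence the Cech complex of this cover computes the
   cohomology of line bundles on [U / G].  Cochains are indexed by all
   (p+1)-tuples of cones. *)
Local Notation cone := {s : set 'rV[R]_2 | cones S s}.
Local Notation cech p := (('I_p.+1 -> cone) -> func).

Definition tuple_outside p (s : 'I_p.+1 -> cone) : {set 'I_n} :=
  (\bigcup_(j < p.+1) outside (projT1 (s j)))%SET.

Definition cochain (r : 'rV[int]_n) (p : nat) : set (cech p) :=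
  [set c | forall s, sections r (tuple_outside s) (c s)].

Definition cech_diff (p : nat) (c : cech p) : cech p.+1 := fun s x =>
  if x \in principal_open (tuple_outside s)
  then \sum_(j < p.+2) (-1) ^+ j * c (fun k => s (lift j k)) x
  else 0.

Definition cocycle (r : 'rV[int]_n) (p : nat) : set (cech p) :=
  [set c | cochain r c /\ cech_diff c = 0].

Definition coboundary (r : 'rV[int]_n) (p : nat) : set (cech p) :=
  match p with
  | 0 => [set 0]
  | q.+1 => [set @cech_diff q c | c in @cochain r q]
  end.

Definition dim_H (p : nat) (r : 'rV[int]_n) (d : nat) :=
  dim_quotient (@cocycle r p) (@coboundary r p) d.

Definition principal_divisors : set 'rV[int]_n :=
  [set r | exists w : {additive lattice -> int}, r = \row_i w (v i)].

(* Elements of Pic are cosets of principal_divisors in Z^n. *)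
Definition line_bundle (r : 'rV[int]_n) : set 'rV[int]_n :=
  [set r' | principal_divisors (r' - r)].

Definition Pic : set (set 'rV[int]_n) := range line_bundle.

Definition Lambda (m : nat) : set (set 'rV[int]_n) :=
  [set L | Pic L /\ exists2 r, L = line_bundle r &
     exists d0 d1 d2, [/\ dim_H 0 r d0, dim_H 1 r d1, dim_H 2 r d2 &
                          (d0 + d1 + d2 < m)%N]].

(* Isomorphic line bundles have the same sections, so the choice of the
   representative r in Lambda is immaterial. *)
Lemma dim_H_line_bundle p r r' d :
  line_bundle r = line_bundle r' -> dim_H p r d -> dim_H p r' d.
Proof.
move=> rr'; have [w rE] : principal_divisors (r - r').
  suff: line_bundle r' r by [].
  by rewrite -rr' /line_bundle /= subrr; exists \0; apply/rowP => i; rewrite !mxE.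
suff secE : sections r = sections r'.
  by case: p => [|p]; rewrite /dim_H /cocycle /coboundary /cochain secE.
have zE z : stack_group z -> \prod_i z 0 i ^ r 0 i = \prod_i z 0 i ^ r' 0 i.
  move=> [z0 zw]; rewrite -[RHS]mul1r -[X in X * _](zw w) -big_split /=.
  apply: eq_bigr => i _; rewrite -expfzDr //; congr (_ ^ _).
  by have /rowP/(_ i) := rE; rewrite !mxE => <-; rewrite subrK.
apply/funext => J; apply/seteqP; split=> f [fr fe f0]; split=> // z x Gz Jx.
  by rewrite fe // zE.
by rewrite fe // zE.
Qed.

End Stack.

(* Main.v *)
From HB Require Import structures.
Require Import Defs.
From mathcomp Require Import all_boot all_order all_algebra.
From mathcomp Require Import boolp classical_sets functions cardinality reals.
From mathcomp Require Import complex ring zify.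
From mathcomp Require Import -(notations) mpoly.

(* The cohomology of O(sum_i r_i E_i) is graded by the exponent vectors
   a = r + (w . v_i)_i, and the degree-a part only depends on which a_i are
   negative: it is nonzero in degree 0 if none is, in degree 2 if all are, and in
   degree 1 if the negative indices are not connected in the cyclic order of the
   rays.

   Let p, i, q be consecutive rays, with a_p, a_i bounded and a_q very large.
   Move w parallel to the line where a_i is constant: every a_j with j <> i then
   varies, since no v_j is collinear with v_i, and for many values of w the
   entries a_p and a_q have the same sign while no a_j with j <> i is small.  For
   such w a bounded translation changes the sign of a_i only.  As the neighbours
   p and q agree, one of the two sign patterns has nonzero cohomology.  Hence, if
   the total dimension is less than m, bounds on a_p and a_i give one on a_q, and
   by going round the fan all a_j are bounded.  Finally, every class in Pic has a
   representative whose entries at two given consecutive rays are bounded. *)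

Set Implicit Arguments.
Unset Strict Implicit.
Unset Printing Implicit Defensive.

Import Order.TTheory GRing.Theory Num.Theory.

Local Open Scope classical_set_scope.
Local Open Scope ring_scope.

(** * Complete fans in the plane *)

(** The determinant of the pair: its sign records orientation, and its vanishing records
    collinearity. *)
Definition cross (K : comRingType) (u w : 'rV[K]_2) : K :=
  u 0 0 * w 0 1 - u 0 1 * w 0 0.

Lemma rV2P (K : Type) (u w : 'rV[K]_2) :
  u 0 0 = w 0 0 -> u 0 1 = w 0 1 -> u = w.
Proof.
move=> h0 h1; apply/rowP => i.
by case: (unliftP ord0 i) => [j ->|->] //; rewrite (ord1 j);
   rewrite (_ : lift ord0 0 = 1) //; apply: val_inj.
Qed.

Lemma crossC (u w : lattice) : cross u w = - cross w u.
Proof. by rewrite /cross; ring. Qed.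

(** Standard scalar product, serving both as a source of elements of N^* and as a positive definite
    form. *)
Definition dual_form (y x : lattice) : int := y 0 0 * x 0 0 + y 0 1 * x 0 1.

Lemma dual_form_is_additive y : zmod_morphism (dual_form y).
Proof. by move=> x x'; rewrite /dual_form !mxE; ring. Qed.

HB.instance Definition _ y :=
  GRing.isZmodMorphism.Build lattice int (dual_form y) (dual_form_is_additive y).

Lemma dual_form_gt0 (u : lattice) : u != 0 -> 0 < dual_form u u.
Proof.
move=> u0; have h : (u 0 0 != 0) || (u 0 1 != 0).
  rewrite -negb_and; apply: contra u0 => /andP[/eqP h0 /eqP h1].
  by apply/eqP/rV2P; rewrite mxE.
by rewrite /dual_form -!expr2; case/orP: h => h;
   [apply: ltr_pwDl|apply: ltr_wpDl]; rewrite ?exprn_even_gt0 ?sqr_ge0.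
Qed.

(** * Cones spanned by two vectors *)

Section RealCones.
Variable R : realType.
Implicit Types (u w : lattice) (p q x : 'rV[R]_2).

Lemma cross_real u w :
  cross (real_vec R u) (real_vec R w) = (cross u w)%:~R.
Proof. by rewrite /cross !mxE -!intrM -intrB. Qed.

Lemma real_vec_eq0 u : (real_vec R u == 0) = (u == 0).
Proof.
apply/eqP/eqP => [/rowP h|->]; last by rewrite /real_vec map_mx0.
by apply/rowP => i; have := h i; rewrite !mxE => /eqP; rewrite intr_eq0 => /eqP.
Qed.

Lemma cross_eq0 p q : p != 0 -> cross p q = 0 -> exists b, q = b *: p.
Proof.
rewrite /cross => p0 c0.
have [p00|p00] := eqVneq (p 0 0) 0.
  have p01 : p 0 1 != 0.
    by apply: contra p0 => /eqP p01; apply/eqP/rV2P; rewrite mxE.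
  exists (q 0 1 / p 0 1); apply: rV2P; rewrite mxE; last by rewrite divfK.
  move: c0; rewrite p00 mul0r sub0r mulr0 => /eqP.
  by rewrite oppr_eq0 mulf_eq0 (negPf p01) => /eqP.
exists (q 0 0 / p 0 0); apply: rV2P; rewrite mxE; first by rewrite divfK.
apply: (mulfI p00); move/eqP: c0; rewrite subr_eq0 => /eqP ->.
by field.
Qed.

Definition cone2 p q : set 'rV[R]_2 :=
  [set x | exists a b, [/\ 0 <= a, 0 <= b & x = a *: p + b *: q]].

Lemma cone2C p q : cone2 p q = cone2 q p.
Proof.
by apply/seteqP; split=> x [a [b [a0 b0 ->]]]; exists b, a; rewrite addrC.
Qed.

(** Cramer's rule: the coordinates of [x] in the basis [p], [q] are quotients of cross products. *)
Lemma cone2P p q x : 0 < cross p q ->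
  cone2 p q x <-> 0 <= cross p x /\ 0 <= cross x q.
Proof.
move=> pq; split=> [[a [b [a0 b0 ->]]]|[px xq]].
  have -> : cross p (a *: p + b *: q) = b * cross p q.
    by rewrite /cross !mxE; ring.
  have -> : cross (a *: p + b *: q) q = a * cross p q.
    by rewrite /cross !mxE; ring.
  by rewrite !mulr_ge0 // ltW.
exists (cross x q / cross p q), (cross p x / cross p q).
rewrite !divr_ge0 ?(ltW pq) //; split=> //.
by apply: rV2P; rewrite !mxE; move: pq; rewrite /cross => /lt0r_neq0 pq;
   field.
Qed.

Lemma cone2_scale p q a b : 0 < a -> 0 < b ->
  cone2 (a *: p) (b *: q) = cone2 p q.
Proof.
move=> a0 b0; apply/seteqP; split=> x [c [d [c0 d0 ->]]].
  exists (c * a), (d * b); rewrite !scalerA.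
  by split=> //; apply: mulr_ge0 => //; exact: ltW.
exists (c / a), (d / b); rewrite !scalerA !divfK ?gt_eqF //.
by split=> //; apply: divr_ge0 => //; exact: ltW.
Qed.

Lemma ray_overE u :
  ray_over (R:=R) u = [set x | exists2 a, 0 <= a & x = a *: real_vec R u].
Proof.
apply/seteqP; split=> x.
  by move=> [t [t0 ->]]; exists (t 0) => //; rewrite big_ord1.
by move=> [a a0 ->]; exists (fun=> a); split=> //; rewrite big_ord1.
Qed.

(** The functional [cross p], with its sign adjusted to be positive on [q], supports the cone
    exactly along [p]. *)
Lemma ray_over_face p q u : cross p q != 0 -> real_vec R u = p ->
  is_face (ray_over (R:=R) u) (cone2 p q).
Proof.
move=> pq up; pose s := Num.sg (cross p q).
exists (\col_i (if i == 0 then - (s * p 0 1) else s * p 0 0)).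
have lE x : (x *m \col_i (if i == 0 then - (s * p 0 1) else s * p 0 0)) 0 0
    = s * cross p x.
  by rewrite !mxE big_ord_recl big_ord1 !mxE /= /cross
    (_ : lift ord0 0 = 1); [ring|apply: val_inj].
have cE a b : s * cross p (a *: p + b *: q) = b * `|cross p q|.
  rewrite normrEsg /cross !mxE /s; ring.
split=> [x [a [b [a0 b0 ->]]]|]; first by rewrite lE cE mulr_ge0.
rewrite ray_overE up; apply/seteqP; split=> x.
  move=> [a a0 ->]; split.
    by exists a, 0; rewrite scale0r addr0.
  by rewrite lE -[a *: p]addr0 -(scale0r q) cE mul0r.
move=> [[a [b [a0 b0 ->]]]]; rewrite lE cE => /eqP.
rewrite mulf_eq0 normr_eq0 (negPf pq) orbF => /eqP ->.
by exists a => //; rewrite scale0r addr0.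
Qed.

End RealCones.

(** * The rays of the fan in cyclic order *)

Section Fan.
Variables (R : realType) (n : nat) (S : stacky_fan R n).
Hypothesis non_collinear :
  forall i j : 'I_n, i != j -> ~ collinear R (vec S i) (vec S j).
Local Notation v := (vec S).
Local Notation rv i := (real_vec R (v i)).

Lemma rv_neq0 i : rv i != 0.
Proof. by rewrite real_vec_eq0 vec_neq0. Qed.

Lemma cross_vec_neq0 i j : i != j -> cross (v i) (v j) != 0.
Proof.
move=> ij; apply/eqP => c0; apply: (non_collinear ij).
exists (rv i); split; first exact: rv_neq0.
have [|b bE] := @cross_eq0 _ (rv i) (rv j) (rv_neq0 i).
  by rewrite cross_real c0.
by exists 1, b; rewrite scale1r.
Qed.

Lemma cross_vec_eq0 i j : (cross (v i) (v j) == 0) = (i == j).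
Proof.
apply/idP/eqP => [|->]; last by rewrite /cross; apply/eqP; ring.
by apply: contraTeq => /cross_vec_neq0.
Qed.

Lemma ray_cone i : cones S (ray_over (R:=R) (v i)).
Proof. by have [h _ _] := vec_rays S; have [] := h i I. Qed.

Lemma ray_vec u : u != 0 -> cones S (ray_over (R:=R) u) ->
  exists i, ray_over (R:=R) u = ray_over (R:=R) (v i).
Proof.
move=> u0 Su; have [_ _ h] := vec_rays S.
by have [|i _ <-] := h (ray_over (R:=R) u); [split=> //; exists u|exists i].
Qed.

Lemma ray_over_eq (u w : lattice) :
  u != 0 -> ray_over (R:=R) u = ray_over (R:=R) w ->
  exists2 a : R, 0 < a & real_vec R u = a *: real_vec R w.
Proof.
move=> u0 uw; have : ray_over (R:=R) u (real_vec R u).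
  by rewrite ray_overE; exists 1; rewrite ?scale1r.
rewrite uw ray_overE => -[a]; rewrite le0r => /orP[/eqP ->|a0 ->]; last by exists a.
by rewrite scale0r => /eqP; rewrite real_vec_eq0 (negPf u0).
Qed.

(** A side of a two-dimensional cone is a face, hence a ray of the fan, and so is spanned by some
    [v i]. *)
Lemma cone_generator (u w : lattice) :
  cross u w != 0 -> cones S (cone2 (real_vec R u) (real_vec R w)) ->
  exists i, exists2 a : R, 0 < a & real_vec R u = a *: rv i.
Proof.
move=> uw Ss; have u0 : u != 0.
  by apply: contra uw => /eqP ->; rewrite /cross !mxE; apply/eqP; ring.
have [_ _ faces _] := cones_fan S.
have [|i /(ray_over_eq u0) ?] := ray_vec u0.
  by apply: (faces _ _ Ss); apply: ray_over_face; rewrite // cross_real intr_eq0.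
by exists i.
Qed.

(** Linear independence allows at most two generators; each one is then replaced by the chosen
    vector on its ray. *)
Lemma cone_cases s : cones S s ->
  [\/ s = [set 0], exists i, s = ray_over (R:=R) (v i) |
      exists i j, 0 < cross (v i) (v j) /\ s = cone2 (rv i) (rv j)].
Proof.
move=> Ss; have [k [u [fu sE]]] := cones_simplicial Ss.
have : (k <= 2)%N by rewrite -(eqP fu) rank_leq_col.
case: k u fu sE => [|[|[|//]]] u fu sE _.
- constructor 1; rewrite sE; apply/seteqP; split=> x /=.
    by move=> [t [_ ->]]; rewrite big_ord0.
  by move=> ->; exists (fun=> 0); rewrite big_ord0.
- constructor 2.
  have uE : u = fun=> u 0 by apply/funext => i; rewrite (ord1 i).
  have sE' : s = ray_over (R:=R) (u 0) by rewrite sE {1}uE.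
  have u0 : u 0 != 0.
    move: fu; rewrite -row_leq_rank; apply: contraL => /eqP u0.
    rewrite (_ : \matrix_j _ = 0) ?mxrank0 //.
    by apply/row_matrixP => j; rewrite rowK (ord1 j) u0 row0 /real_vec map_mx0.
  by have [|i iE] := @ray_vec _ u0; [rewrite -sE'|exists i; rewrite sE'].
constructor 3.
have l1 : lift ord0 (0 : 'I_1) = 1 :> 'I_2 by exact: val_inj.
have uw : cross (u 0) (u 1) != 0.
  rewrite -(intr_eq0 R) -cross_real; apply/eqP => c0.
  move: fu; rewrite row_free_unit unitmxE (expand_det_row _ 0).
  rewrite big_ord_recl big_ord1 l1 /cofactor !det_mx11 !mxE /= !l1.
  rewrite (_ : lift 1 0 = 0); last exact: val_inj.
  move: c0; rewrite /cross !mxE => c0.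
  rewrite unitfE expr0 expr1 mul1r mulN1r mulrN.
  by rewrite c0 eqxx.
have sE2 : s = cone2 (real_vec R (u 0)) (real_vec R (u 1)).
  rewrite sE; apply/seteqP; split=> x /=.
    move=> [t [t0 ->]]; exists (t 0), (t 1); rewrite !t0; split=> //.
    by rewrite big_ord_recl big_ord1 l1.
  move=> [a [b [a0 b0 ->]]]; exists (fun j => if j == 0 then a else b).
  by split=> [j|]; [case: ifP|rewrite big_ord_recl big_ord1 l1].
have [|i [a a0 ui]] := cone_generator uw; first by rewrite -sE2.
have [||j [b b0 uj]] := @cone_generator (u 1) (u 0).
- by apply: contra uw; rewrite /cross => /eqP h; apply/eqP; lia.
- by rewrite cone2C -sE2.
have {}sE2 : s = cone2 (rv i) (rv j) by rewrite sE2 ui uj cone2_scale.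
have ij : i != j.
  apply: contra uw => /eqP ij.
  rewrite -(intr_eq0 R) -cross_real ui uj ij /cross !mxE; apply/eqP; ring.
have := cross_vec_neq0 ij; rewrite neq_lt => /orP[c|c]; last by exists i, j.
exists j, i; split; last by rewrite cone2C.
by move: c; rewrite /cross; lia.
Qed.

(** If [v k] were interior to the cone, its ray would be a face of it. A supporting functional
    vanishing at an interior point vanishes on both generators, so the ray would contain two
    independent vectors. *)
Lemma vec_in_cone2 i j k : 0 < cross (v i) (v j) ->
  cones S (cone2 (rv i) (rv j)) -> cone2 (rv i) (rv j) (rv k) ->
  k = i \/ k = j.
Proof.
move=> ij Ss [a [b [a0 b0 kE]]].
have ij' : (cross (v i) (v j))%:~R != 0 :> R by rewrite intr_eq0 gt_eqF.
have ckj : cross (rv k) (rv j) = a * (cross (v i) (v j))%:~R.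
  by rewrite -cross_real kE /cross !mxE; ring.
have cik : cross (rv i) (rv k) = b * (cross (v i) (v j))%:~R.
  by rewrite -cross_real kE /cross !mxE; ring.
have [az|az] := eqVneq a 0.
  right; apply/eqP; rewrite -cross_vec_eq0 -(intr_eq0 R) -cross_real ckj az.
  by rewrite mul0r.
have [bz|bz] := eqVneq b 0.
  left; apply/eqP; rewrite eq_sym -cross_vec_eq0 -(intr_eq0 R) -cross_real cik.
  by rewrite bz mul0r.
exfalso.
have [_ _ _ inter] := cones_fan S.
have [_] := inter _ _ (ray_cone k) Ss.
have -> : ray_over (R:=R) (v k) `&` cone2 (rv i) (rv j) = ray_over (R:=R) (v k).
  apply/setIidPl; rewrite ray_overE => x [c c0 ->].
  exists (c * a), (c * b); rewrite !mulr_ge0 //; split=> //.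
  by rewrite kE scalerDr !scalerA.
move=> [l [lp lE]].
have inI : cone2 (rv i) (rv j) (rv i).
  by exists 1, 0; rewrite ler01 lexx scale1r scale0r addr0.
have inJ : cone2 (rv i) (rv j) (rv j).
  by exists 0, 1; rewrite ler01 lexx scale1r scale0r add0r.
have : ray_over (R:=R) (v k) (rv k).
  by rewrite ray_overE; exists 1; rewrite ?scale1r.
rewrite lE => -[_]; rewrite kE mulmxDl -!scalemxAl.
rewrite mxE [X in X + _]mxE [X in _ + X]mxE => /eqP.
rewrite paddr_eq0; last 2 first.
- by apply: mulr_ge0 => //; apply: lp.
- by apply: mulr_ge0 => //; apply: lp.
rewrite !mulf_eq0 (negPf az) (negPf bz) => /andP[/eqP li /eqP lj].
have : ray_over (R:=R) (v k) (rv i) by rewrite lE.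
rewrite ray_overE => -[c _ ic].
have : ray_over (R:=R) (v k) (rv j) by rewrite lE.
rewrite ray_overE => -[d _ jd].
move/eqP: ij'; apply; rewrite -cross_real ic jd /cross !mxE; ring.
Qed.

(** The two vectors span a maximal cone, with [v j] on its counterclockwise side. *)
Definition edge i j := 0 < cross (v i) (v j) /\ cones S (cone2 (rv i) (rv j)).

Lemma cone2_lattice i j (x : lattice) : 0 < cross (v i) (v j) ->
  cone2 (rv i) (rv j) (real_vec R x) <->
  0 <= cross (v i) x /\ 0 <= cross x (v j).
Proof.
by move=> ij; rewrite cone2P cross_real ?ltr0z // cross_real ler0z ler0z.
Qed.

Lemma edge_cross i j k : edge i j -> 0 < cross (v i) (v k) ->
  0 < cross (v k) (v j) -> False.
Proof.
move=> [ij Ss] ik kj; have := @vec_in_cone2 i j k ij Ss.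
rewrite cone2_lattice // => /(_ (conj (ltW ik) (ltW kj))).
by move=> [E|E]; subst k; [move: ik|move: kj];
   rewrite lt_neqAle eq_sym cross_vec_eq0 eqxx.
Qed.

(** Of two different followers of [v i], the nearer one would lie strictly inside the cone of the
    other. *)
Lemma edge_fun i j k : edge i j -> edge i k -> j = k.
Proof.
move=> ij ik; apply/eqP; rewrite -cross_vec_eq0.
have := @edge_cross i j k ij (proj1 ik).
have := @edge_cross i k j ik (proj1 ij).
rewrite (crossC (v k)) oppr_gt0.
by case: (ltgtP 0 (cross (v j) (v k))) => // _; [move=> /(_ isT)|move=> _ /(_ isT)].
Qed.

Lemma edge_inj i j k : edge i k -> edge j k -> i = j.
Proof.
move=> ik jk; apply/eqP; rewrite -cross_vec_eq0.
have := @edge_cross i k j ik; have := @edge_cross j k i jk.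
rewrite (crossC (v j)) oppr_gt0 (proj1 ik) (proj1 jk).
case: (ltgtP 0 (cross (v i) (v j))) => // _; first by move=> _ /(_ isT isT).
by move=> /(_ isT isT).
Qed.

(* Look at a cone containing M v_i + J v_i, where J is the quarter turn: for M
   large, the integer cross products with this point force v_i into the cone. *)
Lemma edge_ex i : exists j, edge i j.
Proof.
pose J : lattice := \row_j (if j == 0 then - v i 0 1 else v i 0 0).
have [M MP] : exists M : int, forall k, `|cross J (v k)| < M.
  exists (1 + \sum_k `|cross J (v k)|) => k.
  by rewrite (bigD1 k) //= addrCA ltrDl ltr_pwDl // sumr_ge0.
have iJ : 0 < cross (v i) J.
  rewrite /cross !mxE /= mulrN opprK; exact: dual_form_gt0 (vec_neq0 S i).
pose x := M *: v i + J.
have cxE k : cross x (v k) = M * cross (v i) (v k) + cross J (v k).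
  by rewrite /cross !mxE; ring.
have M0 : 0 < M by apply: le_lt_trans (MP i).
have sgn k : (0 <= cross x (v k) -> 0 <= cross (v i) (v k)) /\
             (cross x (v k) <= 0 -> cross (v i) (v k) <= 0).
  rewrite cxE; have := MP k; split; nia.
have [s Ss sx] := cones_complete S (real_vec R x).
case: (cone_cases Ss) => [sE|[k sE]|[k [l [kl sE]]]].
- exfalso; move: sx; rewrite sE => /eqP; rewrite real_vec_eq0 => /eqP x0.
  have : cross (v i) x = 0 by rewrite x0 /cross !mxE; ring.
  rewrite (_ : cross (v i) x = cross (v i) J) ?(gt_eqF iJ) //.
    by move=> h; rewrite h ltxx in iJ.
  by rewrite /cross !mxE; ring.
- exfalso; move: sx; rewrite sE ray_overE => -[a a0 xE].
  have c0 : cross x (v k) = 0.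
    apply/eqP; rewrite -(intr_eq0 R) -cross_real xE /cross !mxE.
    by apply/eqP; ring.
  have : cross (v i) (v k) == 0.
    by rewrite eq_le (sgn k).1 ?(sgn k).2 // c0.
  rewrite cross_vec_eq0 => /eqP ik; subst k.
  move: c0; rewrite cxE /cross; move: iJ; rewrite /cross; nia.
move: sx; rewrite sE cone2_lattice // => -[kx xl].
have il := (sgn l).1 xl.
have ki : 0 <= cross (v k) (v i).
  by rewrite crossC oppr_ge0; apply: (sgn k).2; rewrite crossC oppr_le0.
have := @vec_in_cone2 k l i kl; rewrite -sE => /(_ Ss).
rewrite sE cone2_lattice // => /(_ (conj ki il)) [ik|il'].
  by subst k; exists l; split=> //; rewrite -sE.
subst l; exfalso; move: xl; rewrite cxE; move: iJ; rewrite /cross; nia.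
Qed.

Definition succ i : 'I_n := projT1 (cid (edge_ex i)).

Lemma succP i : edge i (succ i).
Proof. exact: projT2 (cid (edge_ex i)). Qed.

Lemma succ_inj : injective succ.
Proof. by move=> i j ij; apply: edge_inj (succP i) _; rewrite ij; exact: succP. Qed.

Lemma cross_succ i : 0 < cross (v i) (v (succ i)).
Proof. exact: (succP i).1. Qed.

Lemma succ_neq i : succ i != i.
Proof. by rewrite eq_sym -cross_vec_eq0 gt_eqF ?cross_succ. Qed.

Lemma succ2_neq i : succ (succ i) != i.
Proof.
apply/eqP => h; have := cross_succ (succ i); rewrite h crossC oppr_gt0.
by rewrite ltNge ltW ?cross_succ.
Qed.

Definition max_cone i : set 'rV[R]_2 := cone2 (rv i) (rv (succ i)).

Lemma max_coneP i : cones S (max_cone i).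
Proof. exact: (succP i).2. Qed.

Lemma vec_max_cone i j : max_cone i (rv j) <-> j = i \/ j = succ i.
Proof.
split; first exact: vec_in_cone2 (cross_succ i) (max_coneP i).
move=> [->|->].
  by exists 1, 0; rewrite ler01 lexx scale1r scale0r addr0.
by exists 0, 1; rewrite ler01 lexx scale1r scale0r add0r.
Qed.

(** Two distinct rays rule out the zero cone and the rays, so [s] is a maximal cone and contains
    only the vectors on its two sides. *)
Lemma cone_adjacent s i j : cones S s -> s (rv i) -> s (rv j) -> i != j ->
  (j = succ i \/ i = succ j) /\ forall k, s (rv k) -> k = i \/ k = j.
Proof.
move=> Ss si sj ij.
have on_ray k m : ray_over (R:=R) (v k) (rv m) -> m = k.
  rewrite ray_overE => -[a _ mE]; apply/eqP.
  rewrite -cross_vec_eq0 -(intr_eq0 R) -cross_real mE /cross !mxE.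
  by apply/eqP; ring.
case: (cone_cases Ss) => [sE|[k sE]|[k [l [kl sE]]]].
- by move: si; rewrite sE => /eqP; rewrite (negPf (rv_neq0 i)).
- by move/eqP: ij; case; move: si sj; rewrite sE => /on_ray -> /on_ray ->.
have lE : l = succ k by apply: edge_fun (succP k); split; rewrite -?sE.
move: si sj; rewrite sE lE => /vec_max_cone si /vec_max_cone sj.
split; last first.
  move=> m /vec_max_cone; move: si sj ij.
  by move=> [->|->] [->|->]; rewrite ?eqxx // => _ [->|->]; auto.
by move: si sj ij => [->|->] [->|->]; rewrite ?eqxx // => _; auto.
Qed.

(* If the orbit of i avoids k, then a suffix of it stays on one side of the line
   through v_k, where the slope f decreases strictly along succ: this is absurd
   on a finite orbit. *)
Lemma succ_orbit i k : fconnect succ i k.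
Proof.
apply: contrapT => /negP nik.
pose q := v k; pose V m j := v (iter m succ j).
have Ok m j : fconnect succ i j -> cross (V m j) q != 0.
  move=> ij; rewrite cross_vec_eq0; apply: contra nik => /eqP <-.
  by apply: connect_trans ij _; exact: fconnect_iter.
have up m j : fconnect succ i j -> 0 < cross (V m j) q -> 0 < cross (V m.+1 j) q.
  move=> ij mj; have := Ok m.+1 j ij; rewrite neq_lt => /orP[h|//].
  exfalso; apply: (@edge_cross _ _ k (succP (iter m succ j)) mj).
  by rewrite crossC oppr_gt0.
have [j [e] jP] : exists j (e : int), forall m, 0 < e * cross (V m j) q.
  have [[m mi]|none] := pselect (exists m, 0 < cross (V m i) q).
    exists (iter m succ i), 1; elim=> [|l IH]; first by rewrite mul1r.
    by rewrite mul1r up ?fconnect_iter // -[X in 0 < X]mul1r.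
  exists i, (-1) => m; rewrite mulN1r oppr_gt0 lt_neqAle Ok //= leNgt.
  by apply/negP => h; apply: none; exists m.
pose dot u := dual_form u q.
pose f m : rat := (dot (V m j))%:~R / (cross q (V m j))%:~R.
have qq : 0 < dot q by exact: dual_form_gt0 (vec_neq0 S k).
have f_decr m : f m.+1 < f m.
  have c0 l : cross q (V l j) != 0.
    by apply: contraTneq (jP l) => h; rewrite crossC h oppr0 mulr0 ltxx.
  have cc : 0 < cross q (V m j) * cross q (V m.+1 j).
    have := jP m; have := jP m.+1; rewrite !(crossC _ q); nia.
  rewrite -subr_gt0 /f.
  have -> : (dot (V m j))%:~R / (cross q (V m j))%:~R -
    (dot (V m.+1 j))%:~R / (cross q (V m.+1 j))%:~R =
    (cross (V m j) (V m.+1 j) * dot q)%:~R /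
      (cross q (V m j) * cross q (V m.+1 j))%:~R :> rat.
    rewrite /dot /dual_form /cross !(intrM, intrD, mulrNz).
    have := c0 m; have := c0 m.+1; rewrite -!(intr_eq0 rat) /cross.
    rewrite !(intrM, intrD, mulrNz) => h1 h2.
    by field; rewrite h1 h2.
  by rewrite divr_gt0 // ltr0z // mulr_gt0 // cross_succ.
have {f_decr} : f (order succ j) < f 0%N.
  have : (0 < order succ j)%N by rewrite order_gt0.
  case: (order succ j) => // l _; elim: l => [|l IH]; first exact: f_decr.
  exact: lt_trans (f_decr _) IH.
by rewrite /f /V iter_order ?ltxx //; exact: succ_inj.
Qed.

End Fan.

(** * Coefficients of Laurent polynomials *)

Section Laurent.
Variables (K : numFieldType) (n : nat).
Local Notation point := 'rV[K]_n.
Local Notation func := (point -> K^o).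

Definition torus : set point := [set x | forall i, x 0 i != 0].

(* Dedekind's argument: comparing x with x rescaled by 2 in one coordinate
   eliminates one monomial. *)
Lemma monomials_free (s : seq (multinom n)) (c : multinom n -> K) :
  uniq s ->
  (forall x, torus x -> \sum_(m <- s) c m * \prod_i x 0 i ^+ m i = 0) ->
  forall m, m \in s -> c m = 0.
Proof.
elim: s c => [//|m0 s IH] c /= /andP[m0s us] h.
have cs m : m \in s -> c m = 0.
  move=> ms; have [i im] : exists i, m i != m0 i.
    apply: contrapT => /forallNP e; move: m0s.
    rewrite (_ : m0 = m) ?ms //; apply/mnmP => i.
    by have /negP := e i; rewrite negbK => /eqP.
  have := IH (fun m => c m * (2 ^+ m i - 2 ^+ m0 i)) us _ m ms.
  have step x : torus x ->
      \sum_(m <- s) c m * (2 ^+ m i - 2 ^+ m0 i) * \prod_i x 0 i ^+ m i = 0.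
    move=> Tx; pose y : point := \row_j (if j == i then 2 * x 0 j else x 0 j).
    have Ty : torus y.
      by move=> j; rewrite mxE; case: ifP => _; rewrite ?mulf_neq0 ?pnatr_eq0.
    have yE (m' : multinom n) :
        \prod_j y 0 j ^+ m' j = 2 ^+ m' i * \prod_j x 0 j ^+ m' j.
      rewrite (bigD1 i) //= [in RHS](bigD1 i) //= mulrA mxE eqxx exprMn.
      by congr (_ * _); apply: eq_bigr => j /negPf ji; rewrite mxE ji.
    have := h y Ty; have := h x Tx; rewrite !big_cons yE.
    move=> /(congr1 ( *%R (2 ^+ m0 i))); rewrite mulr0 mulrDr => e1 e2.
    move: (congr2 (fun a b => a - b) e2 e1); rewrite subr0 mulrCA.
    rewrite opprD addrACA subrr add0r mulr_sumr -sumrB => e.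
    rewrite -[RHS]e; apply: eq_bigr => m' _; rewrite yE; ring.
  move=> /(_ step) /eqP; rewrite mulf_eq0 => /orP[/eqP //|].
  by rewrite subr_eq0 -!natrX eqr_nat eqn_exp2l // (negPf im).
move=> m; rewrite inE => /orP[/eqP ->|]; last exact: cs.
have := h (\row__ 1) _; rewrite big_cons big1 ?mulr1; last first.
  by move=> i _; rewrite mxE expr1n.
rewrite [X in c m0 + X]big1_seq ?addr0; last first.
  by move=> m' /andP[_ /cs ->]; rewrite mul0r.
by apply=> i; rewrite mxE oner_neq0.
Qed.

Lemma mpoly_torus_eq0 (P : mpoly n K) :
  (forall x, torus x -> meval (fun i => x 0 i) P = 0) -> P = 0.
Proof.
move=> h; apply/mpolyP => m; rewrite mcoeff0.
have [ms|] := boolP (m \in msupp P); last by apply: memN_msupp_eq0.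
apply: (@monomials_free (msupp P) (fun m => mcoeff m P)) ms.
  exact: msupp_uniq.
by move=> x /h; rewrite mevalE.
Qed.

(** On the torus, [f] is the Laurent polynomial [P] divided by the k-th power of the product of all
    coordinates. *)
Definition laurent (f : func) (P : mpoly n K) (k : nat) :=
  forall x, torus x ->
    f x * (\prod_i x 0 i) ^+ k = meval (fun i => x 0 i) P.

(** The exponent of x^a after multiplication by the common denominator. The absolute value is
    harmless where the sum is nonnegative, as [is_coef] requires. *)
Definition exponent (a : 'rV[int]_n) (k : nat) : multinom n :=
  Multinom [tuple absz (a 0 i + k%:Z) | i < n].

Definition constm (k : nat) : multinom n :=
  Multinom [tuple k | i < n].

Lemma exponentE (a : 'rV[int]_n) k i : exponent a k i = absz (a 0 i + k%:Z).
Proof. by rewrite multinomE tnth_mktuple. Qed.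

Lemma constmE k i : constm k i = k.
Proof. by rewrite multinomE tnth_mktuple. Qed.

Lemma laurent_shift f P k l : laurent f P k ->
  laurent f (P * mpolyX K (constm l)) (k + l).
Proof.
move=> fP x Tx; rewrite mevalM -fP // exprD mulrA; congr (_ * _).
by rewrite mevalX -prodrXl; apply: eq_bigr => i _; rewrite constmE.
Qed.

Lemma laurent_inj f P Q k : laurent f P k -> laurent f Q k -> P = Q.
Proof.
move=> fP fQ; apply/eqP; rewrite -subr_eq0; apply/eqP/mpoly_torus_eq0 => x Tx.
by rewrite mevalB -fP // -fQ // subrr.
Qed.

Definition is_coef (a : 'rV[int]_n) (f : func) (c : K) :=
  exists P k, [/\ laurent f P k, forall i, 0 <= a 0 i + k%:Z &
                  c = mcoeff (exponent a k) P].

Lemma mcoeff_shift (a : 'rV[int]_n) (P : mpoly n K) k l :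
  (forall i, 0 <= a 0 i + k%:Z) ->
  mcoeff (exponent a (k + l)) (P * mpolyX K (constm l)) =
  mcoeff (exponent a k) P.
Proof.
move=> ak; rewrite -[RHS](mcoeffMX _ (constm l)); congr mcoeff.
apply/mnmP => i; rewrite mnmDE !exponentE constmE.
have := ak i; lia.
Qed.

(** Two presentations agree once brought to the common denominator of exponent k + l, and this shift
    preserves the coefficient. *)
Lemma is_coef_inj a f c d : is_coef a f c -> is_coef a f d -> c = d.
Proof.
move=> [P [k [fP ak ->]]] [Q [l [fQ al ->]]].
rewrite -(mcoeff_shift P l ak) -(mcoeff_shift Q k al) addnC.
congr mcoeff; apply: (laurent_inj (laurent_shift l fP)).
by rewrite addnC; exact: laurent_shift.
Qed.

Definition is_laurent f := exists P k, laurent f P k.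

(** The coefficient of x^a in [f], with default value 0 if [f] is not Laurent. *)
Definition lcoef a f : K := xget 0 [set c | is_coef a f c].

Lemma lcoef_eq a f c : is_coef a f c -> lcoef a f = c.
Proof.
move=> fc; apply: (@is_coef_inj a f) => //.
exact: (@xgetI _ 0 [set c | is_coef a f c] c).
Qed.

Lemma vec_bound (a : 'rV[int]_n) :
  exists l : nat, forall k, (l <= k)%N -> forall i, 0 <= a 0 i + k%:Z.
Proof.
exists (\sum_i absz (a 0%R i))%N => k lk i.
have : (absz (a 0%R i) <= \sum_i absz (a 0%R i))%N by rewrite (bigD1 i) //= leq_addr.
lia.
Qed.

Lemma lcoef_ext a f g : (forall x, torus x -> f x = g x) -> lcoef a f = lcoef a g.
Proof.
move=> fg; rewrite /lcoef; congr xget; apply/funext => c; apply/propext.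
by split=> -[P [k [h ? ?]]]; exists P, k; split=> // x Tx;
   rewrite -h ?fg // -fg.
Qed.

Lemma is_laurentD c f g : is_laurent f -> is_laurent g ->
  is_laurent (fun x => c * f x + g x).
Proof.
move=> [P [k fP]] [Q [l gQ]].
exists (c *: (P * mpolyX K (constm l)) + Q * mpolyX K (constm k)).
exists (k + l)%N => x Tx; rewrite mevalD mevalZ.
rewrite -(laurent_shift l fP) // [in RHS]addnC -(laurent_shift k gQ) //.
by rewrite [in RHS]addnC mulrDl mulrA.
Qed.

Lemma lcoefD a c f g : is_laurent f -> is_laurent g ->
  lcoef a (fun x => c * f x + g x) = c * lcoef a f + lcoef a g.
Proof.
move=> [P [k fP]] [Q [l gQ]]; have [m mP] := vec_bound a.
have ak1 : forall i, 0 <= a 0 i + (k + l + m)%N%:Z.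
  by apply: mP; rewrite leq_addl.
have {}fP : laurent f (P * mpolyX K (constm (l + m))) (k + l + m).
  by rewrite -addnA; exact: laurent_shift.
have {}gQ : laurent g (Q * mpolyX K (constm (k + m))) (k + l + m).
  by rewrite (_ : k + l + m = l + (k + m))%N; [exact: laurent_shift|lia].
move: (P * _) (Q * _) fP gQ => {}P {}Q fP gQ.
rewrite (@lcoef_eq a f (mcoeff (exponent a (k + l + m)) P)); last first.
  by exists P, (k + l + m)%N; split.
rewrite (@lcoef_eq a g (mcoeff (exponent a (k + l + m)) Q)); last first.
  by exists Q, (k + l + m)%N; split.
apply: lcoef_eq; exists (c *: P + Q), (k + l + m)%N; split=> //.
  by move=> x Tx; rewrite mevalD mevalZ -fP // -gQ // mulrDl mulrA.
by rewrite mcoeffD mcoeffZ.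
Qed.

Lemma is_laurent0 : is_laurent (fun=> 0).
Proof. by exists 0, 0%N => x _; rewrite mul0r meval0. Qed.

Lemma lcoef0 a : lcoef a (fun=> 0) = 0.
Proof.
apply: lcoef_eq; have [l lP] := vec_bound a; exists 0, l; split; last 1 first.
- by rewrite mcoeff0.
- by move=> x _; rewrite mul0r meval0.
- exact: lP.
Qed.

Lemma laurent_sum a (I : Type) (s : seq I) (c : I -> K) (f : I -> func) :
  (forall j, is_laurent (f j)) ->
  is_laurent (fun x => \sum_(j <- s) c j * f j x) /\
  lcoef a (fun x => \sum_(j <- s) c j * f j x) = \sum_(j <- s) c j * lcoef a (f j).
Proof.
move=> fL; elim: s => [|j s [IH1 IH2]].
  rewrite (_ : (fun x => _) = fun=> 0); last by apply/funext => x; rewrite big_nil.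
  by rewrite big_nil lcoef0; split=> //; exact: is_laurent0.
rewrite (_ : (fun x => _) =
   fun x => c j * f j x + \sum_(j <- s) c j * f j x).
  by rewrite big_cons -IH2; split; [exact: is_laurentD|exact: lcoefD].
by apply/funext => x; rewrite big_cons.
Qed.

Definition monomial (a : 'rV[int]_n) : func := fun x => \prod_i x 0 i ^ a 0 i.

Lemma monomial_laurent (a : 'rV[int]_n) k : (forall i, 0 <= a 0 i + k%:Z) ->
  laurent (monomial a) (mpolyX K (exponent a k)) k.
Proof.
move=> ak x Tx; rewrite mevalX -prodrXl -big_split /=.
apply: eq_bigr => i _; rewrite exponentE !exprnP -expfzDr //.
by congr (_ ^ _); have := ak i; lia.
Qed.

Lemma is_laurent_monomial a : is_laurent (monomial a).
Proof.
have [l /(_ _ (leqnn l)) lP] := vec_bound a.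
by exists (mpolyX K (exponent a l)), l; exact: monomial_laurent.
Qed.

Lemma lcoef_monomial a b : lcoef a (monomial b) = (a == b)%:R.
Proof.
have [k kP] := vec_bound a; have [l lP] := vec_bound b.
have {}kP := kP (k + l)%N (leq_addr _ _).
have {}lP := lP (k + l)%N (leq_addl _ _).
apply: lcoef_eq; exists (mpolyX K (exponent b (k + l))), (k + l)%N.
split=> //; first exact: monomial_laurent.
rewrite mcoeffX; congr (_%:R); congr nat_of_bool.
apply/eqP/eqP => [->//|e]; apply/rowP => i.
have /= := congr1 (fun m : multinom n => m i) e; rewrite !exponentE.
have := kP i; have := lP i; move: (a 0 i) (b 0 i); lia.
Qed.

End Laurent.

(** * Cohomology classes of fixed weight *)

(** Expressing each [z k] modulo [B] through the d generators and applying the dual functionals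
    factors the identity matrix of size m through K^d, so its rank is at most d. The functionals
    need to be linear on [Z] only. *)
Lemma dim_quotient_ge (K : fieldType) (V : lmodType K) (Z B : set V) (d m : nat)
    (z : 'I_m -> V) (lambda : 'I_m -> V -> K) :
  dim_quotient Z B d ->
  Z 0 -> (forall c x y, Z x -> Z y -> Z (c *: x + y)) ->
  (forall k c x y, Z x -> Z y ->
     lambda k (c *: x + y) = c * lambda k x + lambda k y) ->
  (forall k x, B x -> lambda k x = 0) ->
  (forall k, Z (z k)) -> (forall k l, lambda k (z l) = (k == l)%:R) ->
  (m <= d)%N.
Proof.
move=> [b [bZ _ bgen]] Z0 Zlin llin lB zZ lz.
have l0 k : lambda k 0 = 0.
  have := llin k 1 0 0 Z0 Z0; rewrite scale1r addr0 mul1r => /eqP.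
  by rewrite eq_sym -subr_eq0 addrK => /eqP.
have sumP k (c : 'I_d -> K) (s : seq 'I_d) : Z (\sum_(j <- s) c j *: b j) /\
    lambda k (\sum_(j <- s) c j *: b j) = \sum_(j <- s) c j * lambda k (b j).
  elim: s => [|j s [IH1 IH2]]; first by rewrite !big_nil.
  by rewrite !big_cons llin // IH2; split=> //; exact: Zlin.
have /choice[c cP] k := bgen _ (zZ k).
have E : 1%:M = (\matrix_(k < m, j < d) c k j) *m
                (\matrix_(j < d, l < m) lambda l (b j)) :> 'M[K]_m.
  apply/matrixP => k l; rewrite !mxE eq_sym -lz.
  have [Zs ls] := sumP l (c k) (index_enum 'I_d).
  have := lB l _ (cP k).
  rewrite -scaleN1r addrC llin // mulN1r addrC => /eqP; rewrite subr_eq0 => /eqP ->.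
  by rewrite ls; apply: eq_bigr => j _; rewrite !mxE.
by rewrite -(mxrank1 K m) E mulmx_max_rank.
Qed.

(** * The Cech complex graded by weights *)

Section Cech.
Variables (R : realType) (n : nat) (S : stacky_fan R n).
Local Notation C := R[i].
Local Notation point := 'rV[C]_n.
Local Notation func := (point -> C^o).
Local Notation v := (vec S).
Local Notation rv i := (real_vec R (v i)).
Local Notation cone := {s : set 'rV[R]_2 | cones S s}.
Local Notation cech p := (('I_p.+1 -> cone) -> func).
Implicit Types (a r : 'rV[int]_n) (J : {set 'I_n}).

Lemma prod_principal (z : point) a r :
  stack_group S z -> principal_divisors S (a - r) ->
  \prod_i z 0 i ^ a 0 i = \prod_i z 0 i ^ r 0 i.
Proof.
move=> [z0 zw] [w wE]; rewrite -[RHS]mul1r -[X in X * _](zw w) -big_split /=.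
apply: eq_bigr => i _; rewrite -expfzDr //; congr (_ ^ _).
by have /rowP/(_ i) := wE; rewrite !mxE => <-; rewrite subrK.
Qed.

Lemma principal_open_act J (z x : point) : stack_group S z ->
  principal_open J x -> principal_open J (act z x).
Proof. by move=> [z0 _] Jx i iJ; rewrite mxE mulf_neq0 // Jx. Qed.

Lemma sections_linear r J c f g : sections S r J f -> sections S r J g ->
  sections S r J (c *: f + g).
Proof.
move=> [[P [k fP]] fe f0] [[Q [l gQ]] ge g0]; split.
(* The product of the coordinates in [J] as a polynomial, used to bring both fractions to a common
   denominator. *)
- pose h : mpoly n C :=
    mpolyX C (Multinom [tuple nat_of_bool (i \in J) | i < n]).
  have hE x : meval (fun i => x 0 i) h = \prod_(i in J) x 0 i.
    rewrite mevalX [RHS]big_mkcond; apply: eq_bigr => i _.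
    by rewrite multinomE tnth_mktuple; case: ifP.
  exists (c *: (P * h ^+ l) + Q * h ^+ k), (k + l)%N => x Jx.
  rewrite mevalD mevalZ !mevalM !rmorphXn /= hE -fP // -gQ //.
  have E (a b u w : C) : (c * a + b) * (u * w) = c * (a * u * w) + b * w * u by ring.
  by rewrite !fctE exprD; exact: E.
- move=> z x Gz Jx; rewrite !fctE fe // ge //.
  have E (a b u : C) : c * (a * u) + b * u = (c * a + b) * u by ring.
  exact: E.
- by move=> x nJ; rewrite !fctE f0 // g0 // scaler0 addr0.
Qed.

Lemma sections0 r J : sections S r J 0.
Proof.
split=> [|z x _ _|x _] //; last by rewrite [RHS]mul0r.
by exists 0, 0%N => x _; rewrite meval0 mul0r.
Qed.

Definition monomial_on J a : func := fun x =>
  if x \in principal_open J then monomial a x else 0.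

Lemma sections_monomial r J a : principal_divisors S (a - r) ->
  (forall i, i \notin J -> 0 <= a 0 i) -> sections S r J (monomial_on J a).
Proof.
move=> ar a0; split.
- have [l /(_ _ (leqnn l)) lP] := vec_bound a.
  exists (mpolyX C (Multinom
    [tuple (if i \in J then absz (a 0 i + l%:Z) else absz (a 0 i)) | i < n])), l.
  move=> x Jx; rewrite /monomial_on mem_set // mevalX -prodrXl.
  rewrite [X in _ * X]big_mkcond -big_split; apply: eq_bigr => i _ /=.
  rewrite multinomE tnth_mktuple; case: ifPn => iJ.
    rewrite !exprnP -expfzDr; last exact: Jx.
    by congr (_ ^ _); have := lP i; lia.
  by rewrite mulr1 exprnP; congr (_ ^ _); have := a0 i iJ; lia.
- move=> z x Gz Jx; rewrite /monomial_on !mem_set //; last exact: principal_open_act.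
  rewrite -(prod_principal Gz ar) /monomial mulrC -big_split /=.
  by apply: eq_bigr => i _; rewrite mxE expfzMl.
- by move=> x nJ; rewrite /monomial_on memNset.
Qed.

(** Only coordinates in [J] occur in the denominator, so no exponent outside [J] can be negative. *)
Lemma sections_coef r J f : sections S r J f ->
  is_laurent f /\ forall a i, i \notin J -> a 0 i < 0 -> lcoef a f = 0.
Proof.
move=> [[P [k fP]] _ _].
(* Multiplication by this monomial completes the denominator to the power k + l of the product of
   all coordinates; outside [J] every exponent of the numerator is then at least k + l. *)
pose M l : multinom n :=
  Multinom [tuple (l + (if i \in J then 0 else k))%N | i < n].
have fl l : laurent f (P * mpolyX C (M l)) (k + l).
  move=> x Tx; rewrite mevalM -fP; last by move=> i _; exact: Tx.
  rewrite -mulrA; congr (_ * _); rewrite exprD mevalX -!prodrXl.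
  rewrite [X in X * _ = _](bigID (mem J)) /= -mulrA; congr (_ * _).
  rewrite [X in X * _ = _]big_mkcond -big_split /=; apply: eq_bigr => i _.
  by rewrite multinomE tnth_mktuple exprD mulrC; case: (i \in J).
split=> [|a i iJ ai]; first by exists (P * mpolyX C (M 0)), (k + 0)%N.
have [l lP] := vec_bound a.
apply: lcoef_eq; exists (P * mpolyX C (M l)), (k + l)%N; split.
- exact: fl.
- by apply: lP; rewrite leq_addl.
apply/esym/memN_msupp_eq0.
rewrite (perm_mem (msuppMX _ _)); apply/mapP => -[m _ e].
have /= := congr1 (fun m : multinom n => m i) e.
rewrite exponentE mnmDE multinomE tnth_mktuple (negPf iJ).
have := lP (k + l)%N (leq_addl _ _) i; move: (a 0 i) ai => ai; lia.
Qed.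

(* Scalar Cech cochains: the coefficients of a fixed Laurent monomial. *)
Local Notation scalar p := (('I_p.+1 -> cone) -> C).

Definition delta p (g : scalar p) : scalar p.+1 := fun s =>
  \sum_(j < p.+2) (-1) ^+ j * g (fun k => s (lift j k)).

Definition weight_cochain a p (g : scalar p) : cech p := fun s =>
  g s *: monomial_on (tuple_outside s) a.

(* The monomial of exponent a is not a section over the intersection of s. *)
Definition blocked a p (s : 'I_p.+1 -> cone) :=
  exists i, a 0 i < 0 /\ i \notin tuple_outside s.

Lemma notin_tuple_outside p (s : 'I_p.+1 -> cone) i :
  i \notin tuple_outside s <-> forall j, projT1 (s j) (rv i).
Proof.
split=> [h j|h].
  apply/set_mem; apply: contraNT h => h.
  by apply/bigcupP; exists j => //; rewrite inE.
apply/negP => /bigcupP[j _]; rewrite inE => /negP; apply; apply/mem_set; exact: h.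
Qed.

Lemma weight_cochainP r a p (g : scalar p) : principal_divisors S (a - r) ->
  (forall s, blocked a s -> g s = 0) -> cochain r (weight_cochain a g).
Proof.
move=> ar g0 s; rewrite /weight_cochain.
have [/g0 ->|nb] := pselect (blocked a s).
  by rewrite scale0r; exact: sections0.
rewrite -[_ *: _]addr0; apply: sections_linear; last exact: sections0.
apply: sections_monomial => // i iJ; rewrite leNgt; apply/negP => ai.
by apply: nb; exists i.
Qed.

Lemma principal_open_lift p (s : 'I_p.+2 -> cone) (j : 'I_p.+2) (x : point) :
  principal_open (tuple_outside s) x ->
  principal_open (tuple_outside (fun k => s (lift j k))) x.
Proof.
by move=> sx i /bigcupP[k _ h]; apply: sx; apply/bigcupP; exists (lift j k).
Qed.

Lemma principal_open_torus J (x : point) : torus x -> principal_open J x.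
Proof. by move=> Tx i _; exact: Tx. Qed.

Lemma diff_weight_cochain a p (g : scalar p) :
  cech_diff (weight_cochain a g) = weight_cochain a (delta g).
Proof.
apply/funext => s; apply/funext => x; rewrite /cech_diff /weight_cochain !fctE.
rewrite /monomial_on; case: ifPn => [/set_mem sx|_]; last by rewrite scaler0.
rewrite [RHS]mulr_suml; apply: eq_bigr => j _.
by rewrite !fctE mem_set ?mulrA //; exact: principal_open_lift.
Qed.

Lemma cech_diff_linear p c (x y : cech p) :
  cech_diff (c *: x + y) = c *: cech_diff x + cech_diff y.
Proof.
apply/funext => s; apply/funext => t; rewrite /cech_diff !fctE.
case: ifP => _; last by rewrite scaler0 addr0.
rewrite scaler_sumr -big_split; apply: eq_bigr => j _ /=.
by rewrite !fctE mulrDr; congr (_ + _); rewrite /GRing.scale /= mulrCA.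
Qed.

Lemma coef_weight_cochain a b p (g : scalar p) s :
  lcoef a (weight_cochain b g s) = g s * (a == b)%:R.
Proof.
rewrite (@lcoef_ext _ _ _ _ (fun x => g s * monomial b x + 0)); last first.
  move=> x Tx; rewrite addr0 /weight_cochain !fctE /monomial_on.
  by rewrite mem_set //; exact: principal_open_torus.
rewrite lcoefD; last 2 first.
- exact: is_laurent_monomial.
- exact: is_laurent0.
by rewrite lcoef0 addr0 lcoef_monomial.
Qed.

Lemma coef_cech_diff r a p (c : cech p) s : cochain r c ->
  lcoef a (cech_diff c s) = delta (fun t => lcoef a (c t)) s.
Proof.
move=> rc; rewrite (@lcoef_ext _ _ _ _
   (fun x => \sum_(j < p.+2) (-1) ^+ j * c (fun k => s (lift j k)) x)).
  by apply: (laurent_sum _ _ _ _).2 => j; exact: (sections_coef (rc _)).1.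
by move=> x Tx; rewrite /cech_diff mem_set //; exact: principal_open_torus.
Qed.

Lemma coef_blocked r a p (c : cech p) s : cochain r c -> blocked a s ->
  lcoef a (c s) = 0.
Proof. by move=> rc [i [ai si]]; apply: (sections_coef (rc s)).2 ai. Qed.

(* A weight-a cocycle g, and a relative cycle (a finite combination of tuples)
   modulo the blocked tuples, pairing to 1 with g. *)
Definition weight_class p a := exists (g : scalar p) (N : nat)
    (e : 'I_N -> C) (sg : 'I_N -> 'I_p.+1 -> cone),
  [/\ forall s, blocked a s -> g s = 0, delta g = 0,
      \sum_l e l * g (sg l) = 1 &
      match p return ('I_N -> 'I_p.+1 -> cone) -> Prop with
      | 0 => fun=> True
      | q.+1 => fun sg => forall b : scalar q,
          (forall s, blocked a s -> b s = 0) -> \sum_l e l * delta b (sg l) = 0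
      end sg].

(** The functional takes degree-a coefficients and pairs them with the relative cycle. Taking
    coefficients commutes with the differential and gives 0 on blocked tuples, so coboundaries are
    killed; cochains of other weights have no degree-a coefficient. *)
Lemma weight_class_functional r p a : principal_divisors S (a - r) ->
  weight_class p a ->
  exists (g : scalar p) (lambda : cech p -> C),
  [/\ cocycle r (weight_cochain a g),
      forall c x y, cochain r x -> cochain r y ->
        lambda (c *: x + y) = c * lambda x + lambda y,
      forall x, coboundary r x -> lambda x = 0 &
      forall b h, lambda (weight_cochain b h) =
        if a == b then lambda (weight_cochain a h) else 0] /\
  lambda (weight_cochain a g) = 1.
Proof.
move=> ar [g [N [e [sg [gb dg eg bd]]]]].
exists g, (fun c => \sum_l e l * lcoef a (c (sg l))); split; last first.
  by rewrite -[RHS]eg; apply: eq_bigr => l _; rewrite coef_weight_cochain eqxx mulr1.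
split.
- split; first exact: weight_cochainP.
  rewrite diff_weight_cochain dg; apply/funext => s; apply/funext => x.
  by rewrite /weight_cochain !fctE scale0r.
- move=> c x y xr yr; rewrite mulr_sumr -big_split; apply: eq_bigr => l _ /=.
  have /= := lcoefD a c (sections_coef (xr (sg l))).1 (sections_coef (yr (sg l))).1.
  move=> h; rewrite mulrCA -mulrDr -h; congr (_ * _).
- case: p e sg g gb dg eg bd => [|q] e sg g gb dg eg bd x.
    by move=> ->; apply: big1 => l _; rewrite lcoef0 mulr0.
  move=> [c rc <-]; rewrite -[RHS](bd (fun t => lcoef a (c t))).
    by apply: eq_bigr => l _; rewrite (coef_cech_diff _ _ rc).
  by move=> s; exact: coef_blocked rc.
- move=> b h; case: ifP => [/eqP ->//|ab]; apply: big1 => l _.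
  by rewrite coef_weight_cochain ab !mulr0.
Qed.

(** Classes of distinct weights are independent, because the functional of each weight vanishes on
    the classes of the others. *)
Lemma dim_H_ge p r d (A : seq 'rV[int]_n) : uniq A ->
  (forall a, a \in A -> principal_divisors S (a - r) /\ weight_class p a) ->
  dim_H S p r d -> (size A <= d)%N.
Proof.
move=> uA AP dH; pose al (k : 'I_(size A)) := nth 0 A k.
have alP k : al k \in A by exact: mem_nth.
have /choice[g /choice[lam H]] :=
  fun k => weight_class_functional (AP _ (alP k)).1 (AP _ (alP k)).2.
apply: (dim_quotient_ge (z := fun k => weight_cochain (al k) (g k))
                        (lambda := lam) dH).
- split; first by move=> s; exact: sections0.
  apply/funext => s; apply/funext => x; rewrite /cech_diff; case: ifP => // _.
  by apply: big1 => j _; rewrite mulr0.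
- move=> c x y [xr dx] [yr dy]; split; first by move=> s; exact: sections_linear.
  by rewrite cech_diff_linear dx dy scaler0 addr0.
- by move=> k c x y [xr _] [yr _]; have [[_ h _ _] _] := H k; exact: h.
- by move=> k x; have [[_ _ h _] _] := H k; exact: h.
- by move=> k; have [[]] := H k.
move=> k l; have [[_ _ _ h] h1] := H k; rewrite h.
have -> : (al k == al l) = (k == l).
  by rewrite nth_uniq.
by case: eqVneq => // <-.
Qed.

(** * Explicit classes in degrees 0, 1 and 2 *)

Definition tuple1 (x : cone) : 'I_1 -> cone := fun=> x.
Definition tuple2 (x y : cone) : 'I_2 -> cone := fun m => nth x [:: x; y] m.
Definition tuple3 (x y z : cone) : 'I_3 -> cone := fun m => nth x [:: x; y; z] m.

Lemma delta_tuple2 (b : scalar 0) x y :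
  delta b (tuple2 x y) = b (tuple1 y) - b (tuple1 x).
Proof.
rewrite /delta big_ord_recl big_ord1 expr0 expr1 mul1r mulN1r.
by congr (b _ - b _); apply/funext => m; rewrite (ord1 m).
Qed.

Lemma delta_tuple3 (b : scalar 1) x y z :
  delta b (tuple3 x y z) = b (tuple2 y z) - b (tuple2 x z) + b (tuple2 x y).
Proof.
rewrite /delta !big_ord_recl big_ord0 addr0 expr0 expr1 mul1r mulN1r.
rewrite -[_ ^+ _]/(-1 * -1) mulrNN !mul1r addrA.
by congr (b _ - b _ + b _); apply/funext => -[[|[|[]]]].
Qed.

Lemma blocked_tuple2 a i (x y : cone) :
  a 0 i < 0 -> projT1 x (rv i) -> projT1 y (rv i) -> blocked a (tuple2 x y).
Proof.
move=> ai xi yi; exists i; split=> //; apply/notin_tuple_outside => -[[|[|//]] h].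
  exact: xi.
exact: yi.
Qed.

(** No tuple is blocked, so the constant 1 is an admissible cocycle; it is evaluated at a single
    cone. *)
Lemma weight_class0 a : (forall i, 0 <= a 0 i) -> weight_class 0 a.
Proof.
move=> a0; have [s0 Ss0 _] := cones_complete S 0.
exists (fun=> 1), 1%N, (fun=> 1), (fun=> tuple1 (exist _ s0 Ss0)); split=> //.
- by move=> s [i [ai _]]; move: (a0 i); rewrite leNgt ai.
- apply/funext => s; rewrite /delta big_ord_recl big_ord1.
  by rewrite expr0 expr1 !mulr1 subrr.
- by rewrite big_ord1 mulr1.
Qed.

(** When no cone joins the negative rays in [A] to those outside, the class is the coboundary of the
    indicator [e] of the cones meeting the negative rays in [A]. On cones sharing a negative ray [e]
    is constant, so this coboundary vanishes on blocked pairs. *)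
Lemma weight_class1 a (A : {set 'I_n}) :
  (exists2 i, i \in A & a 0 i < 0) -> (exists2 j, j \notin A & a 0 j < 0) ->
  (forall s i j, cones S s -> s (rv i) -> s (rv j) -> i \in A -> j \notin A ->
     a 0 i < 0 -> a 0 j < 0 -> False) ->
  weight_class 1 a.
Proof.
move=> [i iA ai] [j jA aj] sep.
pose meetsA (s : cone) := exists k, [/\ k \in A, a 0 k < 0 & projT1 s (rv k)].
pose e (s : cone) : C := `[< meetsA s >]%:R.
have ray_in k : ray_over (R:=R) (v k) (rv k).
  by rewrite ray_overE; exists 1; rewrite ?scale1r.
pose sA : cone := exist _ _ (ray_cone S i).
pose sB : cone := exist _ _ (ray_cone S j).
have eA : e sA = 1.
  by rewrite /e; case: asboolP => // -[]; exists i; split=> //; exact: ray_in.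
have eB : e sB = 0.
  rewrite /e; case: asboolP => // -[k [kA ak jk]].
  by case: (sep (projT1 sB) k j) => //; [exact: projT2|exact: ray_in].
(* The relative cycle is one edge from the ray of [v j] to that of [v i]; both of its endpoints are
   blocked. *)
exists (fun s => e (s 1) - e (s 0)), 1%N, (fun=> 1), (fun=> tuple2 sB sA); split.
- move=> s [k [ak /notin_tuple_outside sk]].
  apply/eqP; rewrite subr_eq0; apply/eqP.
  suff E (t : cone) : projT1 t (rv k) -> e t = (k \in A)%:R by rewrite !E.
  move=> tk; rewrite /e; case: asboolP => [[l [lA al tl]]|nA].
    case: (boolP (k \in A)) => // kA; exfalso.
    exact: (sep (projT1 t) l k (projT2 t)).
  by case: (boolP (k \in A)) => // kA; case: nA; exists k.
- apply/funext => s; pose t k := s (inord k).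
  have sE k : s k = t k by rewrite /t inord_val.
  rewrite /delta !big_ord_recl big_ord0 !sE.
  (* The iterated [lift] indices compute to these entries by conversion, after which the sum cancels
     identically. *)
  transitivity (1 * (e (t 2%N) - e (t 1%N)) + (-1 * (e (t 2%N) - e (t 0%N)) +
    (-1 * -1 * (e (t 1%N) - e (t 0%N)) + 0))); first by [].
  by rewrite [RHS]/(0 : C); ring.
- by rewrite big_ord1 mul1r [e (tuple2 _ _ _)]eA [e _]eB subr0.
- move=> b bb; rewrite big_ord1 mul1r delta_tuple2 !bb ?subrr //.
    by exists j; split=> //; apply/notin_tuple_outside => k; exact: ray_in.
  by exists i; split=> //; apply/notin_tuple_outside => k; exact: ray_in.
Qed.

Hypothesis non_collinear :
  forall i j : 'I_n, i != j -> ~ collinear R (vec S i) (vec S j).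
Local Notation succ := (succ non_collinear).

Definition max_cone_at i : cone := exist _ _ (max_coneP non_collinear i).

(* Reduced H^1 of the cycle of rays: g is the coboundary of a cochain h that
   jumps by 1 when going round the fan through v_i0. *)
Lemma weight_class2 a (i0 : 'I_n) : (forall i, a 0 i < 0) -> weight_class 2 a.
Proof.
move=> a0; pose chi i (s : cone) : C := `[< projT1 s (rv i) >]%:R.
have chi1 i (s : cone) : projT1 s (rv i) -> chi i s = 1.
  by move=> h; rewrite /chi; case: asboolP.
pose h (s t : cone) : C := chi i0 s * chi i0 t * (chi (succ i0) t - chi (succ i0) s).
have h0 i (s t : cone) : i != i0 -> projT1 s (rv i) -> projT1 t (rv i) -> h s t = 0.
  move=> ii si ti; rewrite /h.
  suff E (u : cone) : projT1 u (rv i) -> projT1 u (rv i0) ->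
      chi (succ i0) u = (i == succ i0)%:R.
    rewrite {1 2}/chi; case: asboolP => s0; last by rewrite !mul0r.
    case: asboolP => t0; last by rewrite mulr0 mul0r.
    by rewrite !E // subrr mulr0.
  move=> ui u0; rewrite eq_sym /chi; congr (nat_of_bool _)%:R.
  have [_ uP] := cone_adjacent non_collinear (projT2 u) ui u0 ii.
  apply/asboolP/eqP => [/uP[//|/eqP]|->//].
  by rewrite (negPf (succ_neq _ _)).
pose g (s : 'I_3 -> cone) : C :=
  h (s 1) (s ord_max) - h (s 0) (s ord_max) + h (s 0) (s 1).
pose N := order succ i0; pose it k := iter k succ i0.
pose c k := max_cone_at (it k).
have itN : it N = i0 by apply: iter_order; exact: succ_inj.
have cN : c N = c 0%N by rewrite /c itN.
have c_it k : projT1 (c k) (rv (it k)) by apply/vec_max_cone; left.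
have c_it1 k : projT1 (c k) (rv (it k.+1)) by apply/vec_max_cone; right.
have telescope (f : cone -> cone -> C) : f (c 0%N) (c 0%N) = 0 ->
    \sum_(k < N) (f (c k) (c k.+1) - f (c 0%N) (c k.+1) + f (c 0%N) (c k)) =
    \sum_(k < N) f (c k) (c k.+1).
  move=> f0; have T := telescope_sumr (fun k => f (c 0%N) (c k)) (leq0n N).
  rewrite /= cN f0 subrr big_mkord in T.
  by rewrite -[RHS]subr0 -[X in _ - X]T -sumrB; apply: eq_bigr => k _; ring.
(* The relative cycle is the closed polygon of maximal cones, filled by triangles with apex [c 0].
   By [telescope], only its sides contribute. *)
exists g, N, (fun=> 1), (fun k : 'I_N => tuple3 (c 0%N) (c k) (c k.+1)); split.
- move=> s [i [_ /notin_tuple_outside si]]; rewrite /g.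
  have [E|ii] := eqVneq i i0; last by rewrite !(h0 i) // subrr add0r.
  by subst i; rewrite /h !(chi1 i0) //; ring.
- apply/funext => s; pose t k := s (inord k).
  have sE k : s k = t k by rewrite /t inord_val.
  rewrite /delta !big_ord_recl big_ord0 /g !sE.
  transitivity (1 * (h (t 2%N) (t 3%N) - h (t 1%N) (t 3%N) + h (t 1%N) (t 2%N)) +
    (-1 * (h (t 2%N) (t 3%N) - h (t 0%N) (t 3%N) + h (t 0%N) (t 2%N)) +
    (-1 * -1 * (h (t 1%N) (t 3%N) - h (t 0%N) (t 3%N) + h (t 0%N) (t 1%N)) +
    (-1 * (-1 * -1) *
       (h (t 1%N) (t 2%N) - h (t 0%N) (t 2%N) + h (t 0%N) (t 1%N)) + 0))));
    first by [].
  by rewrite [RHS]/(0 : C); ring.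
- rewrite -[RHS](_ : \sum_(k < N) h (c k) (c k.+1) = 1).
    rewrite -telescope; last by rewrite /h subrr mulr0.
    by apply: eq_bigr => k _; rewrite mul1r.
  have : (0 < N)%N by exact: order_gt0.
  (* Only the last side contributes: it joins the two maximal cones containing [v i0], and no other
     consecutive pair has both members containing it. *)
  case NE : N => [//|M] _; rewrite big_ord_recr /= big1 ?add0r; last first.
    move=> k _; rewrite /h {1 2}/chi.
    case: asboolP => [/vec_max_cone ck|_]; last by rewrite !mul0r.
    case: asboolP => [/vec_max_cone ck1|_]; last by rewrite mulr0 mul0r.
    exfalso.
    have k1 : i0 <> it k.+1.
      move=> E; have := @findex_iter _ succ i0 k.+1.
      rewrite -/N NE ltnS ltn_ord => /(_ isT).
      by rewrite -/(it k.+1) -E findex0.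
    case: ck => [ck|//]; case: ck1 => [//|].
    by rewrite {1}ck => /esym/eqP; apply/negP; exact: succ2_neq.
  rewrite -NE cN /h (chi1 i0 (c 0%N)); last exact: (c_it 0%N).
  rewrite (chi1 i0 (c M)); last by rewrite -[X in rv X]itN NE; exact: c_it1.
  rewrite (chi1 _ (c 0%N)); last exact: (c_it1 0%N).
  rewrite /chi; case: asboolP => [|_]; last by rewrite !mul1r subr0.
  move=> /vec_max_cone[E|].
    have : succ (succ i0) = i0 by rewrite {1}E -[RHS]itN NE.
    by move/eqP; rewrite (negPf (succ2_neq _ _)).
  move=> E; have : succ i0 = i0 by rewrite E -[RHS]itN NE.
  by move/eqP; rewrite (negPf (succ_neq _ _)).
(* Consecutive maximal cones share a ray, and all entries of [a] are negative, so every side of the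
   polygon is blocked. *)
- move=> b bb; rewrite (eq_bigr (fun k : 'I_N =>
    b (tuple2 (c k) (c k.+1)) - b (tuple2 (c 0%N) (c k.+1)) +
    b (tuple2 (c 0%N) (c k)))).
    rewrite (telescope (fun x y => b (tuple2 x y))).
      apply: big1 => k _; apply: bb; apply: (@blocked_tuple2 _ (it k.+1)) => //.
    by apply: bb; apply: (@blocked_tuple2 _ i0) => //; exact: (c_it 0%N).
  by move=> k _; rewrite mul1r delta_tuple3.
Qed.

End Cech.

(** * Counting contributing weights *)

(** The values x + t d + E are distinct and lie between 0 and 2E. *)
Lemma count_near (x d : int) (E : nat) (ts : seq nat) : d != 0 -> uniq ts ->
  (count (fun t : nat => `|x + t%:Z * d|%R <= E%:Z)%R ts <= E.*2.+1)%N.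
Proof.
move=> d0 uts; rewrite -size_filter; set us := filter _ _.
pose f (t : nat) := absz (x + t%:Z * d + E%:Z).
rewrite -(size_map f us) -[X in (_ <= X)%N](size_iota 0).
apply: uniq_leq_size.
  rewrite map_inj_in_uniq ?filter_uniq // => t t'; rewrite !mem_filter.
  move=> /andP[h _] /andP[h' _]; rewrite /f => tt'.
  have : t%:Z * d = t'%:Z * d by move: (_ * d) (t'%:Z * d) h h' tt' => ??; lia.
  by move=> /(mulIf d0) [].
move=> y /mapP[t]; rewrite mem_filter mem_iota => /andP[h _] ->.
by rewrite /f; move: (_ * d) h => ?; lia.
Qed.

(** A union bound over the indices j other than i, each excluding at most 2E + 1 values of t. *)
Lemma count_avoid (n E : nat) (x d : 'I_n -> int) (ts : seq nat) (i : 'I_n) :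
  (forall j, j != i -> d j != 0) -> uniq ts ->
  (size ts <= n * E.*2.+1 +
     count (fun t : nat =>
       [forall j, (j != i) ==> (E%:Z < `|x j + t%:Z * d j|)%R]) ts)%N.
Proof.
move=> d0 uts; rewrite -[X in (X <= _)%N](count_predC
  (fun t : nat => [forall j, (j != i) ==> (E%:Z < `|x j + t%:Z * d j|)%R])) addnC.
rewrite leq_add2r.
pose bad j (t : nat) := (j != i) && (`|x j + t%:Z * d j| <= E%:Z).
apply: (@leq_trans (\sum_(j < n) count (bad j) ts)).
  elim: ts {uts} => [|t ts IH] /=; first by rewrite big1.
  rewrite big_split /= leq_add // negb_forall.
  case: existsP => // -[j]; rewrite negb_imply -leNgt => bj.
  by rewrite (bigD1 j) //= /bad bj.
rewrite -[X in (X * _)%N](card_ord n) -sum_nat_const; apply: leq_sum => j _.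
have [->|ji] := eqVneq j i.
  by rewrite /bad eqxx /= count_pred0.
by rewrite /bad ji; apply: count_near => //; exact: d0.
Qed.

(** * Sign patterns and bounds on weights *)

Section Bound.
Variables (R : realType) (n : nat) (S : stacky_fan R n).
Hypothesis non_collinear :
  forall i j : 'I_n, i != j -> ~ collinear R (vec S i) (vec S j).
Local Notation v := (vec S).
Local Notation succ := (succ non_collinear).
Implicit Types a b r : 'rV[int]_n.

Definition contributes a :=
  [\/ weight_class S 0 a, weight_class S 1 a | weight_class S 2 a].

Lemma succ_index i j (idx := findex succ i) :
  (idx j < order succ i)%N /\ (succ j = i \/ idx (succ j) = (idx j).+1).
Proof.
have jO := succ_orbit non_collinear i j.
have lt := findex_max jO; split=> //.
have := @iter_findex _ succ i j jO; rewrite -/(idx j) => jE.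
have : ((idx j).+1 <= order succ i)%N by [].
rewrite leq_eqVlt => /orP[/eqP E|h]; [left|right].
  by rewrite -{1}jE -iterS E iter_order //; exact: succ_inj.
by rewrite /idx -{1}jE -iterS findex_iter.
Qed.

(* Flipping the sign at i between two equal neighbours changes the number of
   sign changes around the fan by 2, and only 2 sign changes give no cohomology. *)
Lemma sign_flip a b p (i := succ p) (q := succ i) :
  (forall j, j != i -> (0 <= a 0 j) = (0 <= b 0 j)) ->
  (0 <= a 0 i) != (0 <= b 0 i) -> (0 <= a 0 p) = (0 <= a 0 q) ->
  contributes a \/ contributes b.
Proof.
wlog ai : a b / 0 <= a 0 i.
  move=> W ab abi apq; have [ai|ai] := boolP (0 <= a 0 i); first exact: W.
  apply/or_comm/(W b a) => //.
  - by move: abi; rewrite (negPf ai); case: (0 <= b 0 i).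
  - by move=> j /ab.
  - by rewrite eq_sym.
  by rewrite -!ab // ?succ_neq // eq_sym succ_neq.
rewrite ai => ab bi apq.
have {}bi : b 0 i < 0 by rewrite ltNge; case: (0 <= b 0 i) bi.
have pi : p != i by rewrite eq_sym succ_neq.
have qi : q != i by exact: succ_neq.
have [ap|ap] := leP 0 (a 0 p).
  have [[k [ki ak]]|none] := pselect (exists k, k != i /\ a 0 k < 0); last first.
    left; constructor 1; apply: weight_class0 => j.
    have [->//|ji] := eqVneq j i; rewrite leNgt; apply/negP => aj.
    by apply: none; exists j.
  (* For [b], the negative ray i is isolated between two nonnegative neighbours, and k is another
     negative ray. *)
  right; constructor 2; apply: (@weight_class1 _ _ _ _ [set i]%SET).
  - by exists i; rewrite ?inE.
  - by exists k; rewrite ?inE // ltNge -ab // -ltNge.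
  move=> s i' j Ss si sj; rewrite !inE => /eqP E ji _ bj; subst i'.
  have ij : i != j by rewrite eq_sym.
  have [[E|/succ_inj E] _] := cone_adjacent non_collinear Ss si sj ij.
    by move: bj; rewrite ltNge -ab // E -apq ap.
  by move: bj; rewrite ltNge -ab // -E ap.
have aq : a 0 q < 0 by rewrite ltNge -apq -ltNge.
have [[k [ki ak]]|none] := pselect (exists k, k != i /\ 0 <= a 0 k); last first.
  right; constructor 3; apply: (weight_class2 non_collinear i) => j.
  have [->//|ji] := eqVneq j i; rewrite ltNge -ab //; apply/negP => aj.
  by apply: none; exists j.
pose idx := findex succ i.
have idx_inj j j' : idx j = idx j' -> j = j'.
  move=> E; rewrite -(iter_findex (succ_orbit non_collinear i j)).
  by rewrite -/(idx j) E iter_findex // succ_orbit.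
have idxi : idx i = 0%N by rewrite /idx findex0.
have idxq : idx q = 1%N.
  have [_ [E|E]] := succ_index i i; first by move: qi; rewrite -E eqxx.
  by rewrite [LHS]E findex0.
left; constructor 2.
(* Counting from i, the rays i and k, nonnegative for [a], cut the cycle into two arcs: the first
   contains q, the second contains p, the last ray before i. *)
apply: (@weight_class1 _ _ _ _ [set j | (idx j < idx k)%N]%SET).
- exists q; rewrite ?inE // idxq ltn_neqAle lt0n; apply/andP; split.
    apply/eqP => E; move: ak; rewrite leNgt -(idx_inj q k) ?aq //.
    by rewrite idxq.
  by apply/eqP => E; move/eqP: ki; apply; apply: idx_inj; rewrite E idxi.
- exists p => //; rewrite inE -leqNgt.
  have [kO _] := succ_index i k; have := @findex_iter _ succ i (idx p).+1.
  have [pO _] := succ_index i p.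
  rewrite iterS iter_findex ?succ_orbit // -/i findex0.
  case: (ltnP (idx p).+1 (order succ i)) => [_ /(_ isT)//|h _].
  exact: leq_trans kO h.
move=> s j j' Ss sj sj'; rewrite !inE -leqNgt => jk kj' aj aj'.
have jj' : j != j'.
  by apply/eqP => E; move: jk; rewrite ltnNge E kj'.
have neg_i l : a 0 l < 0 -> l <> i by move=> + E; rewrite E ltNge ai.
have [[E|E] _] := cone_adjacent non_collinear Ss sj sj' jj'.
  have [_ [F|F]] := succ_index i j.
    by case: (neg_i _ aj'); rewrite E F.
  have kE : k = j'.
    by apply: idx_inj; apply/eqP; rewrite eqn_leq kj' E [X in (X <= _)%N]F.
  by move: aj'; rewrite -kE ltNge ak.
have [_ [F|F]] := succ_index i j'.
  by case: (neg_i _ aj); rewrite E F.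
move: jk; rewrite E [X in (X < _)%N]F => h.
by have := leq_trans h kj'; rewrite ltnNge leqnSn.
Qed.

(** Every weight in [A] is counted in at least one of the three degrees, where [dim_H_ge]
    applies. *)
Lemma contributes_count a (A : seq 'rV[int]_n) d0 d1 d2 : uniq A ->
  (forall b, b \in A -> principal_divisors S (b - a) /\ contributes b) ->
  dim_H S 0 a d0 -> dim_H S 1 a d1 -> dim_H S 2 a d2 ->
  (size A <= d0 + d1 + d2)%N.
Proof.
move=> uA AP D0 D1 D2.
pose W p := [pred b | `[< weight_class S p b >]].
have le p d : dim_H S p a d -> (count (W p) A <= d)%N.
  move=> Dp; rewrite -size_filter; apply: (dim_H_ge _ _ Dp).
    exact: filter_uniq.
  move=> b; rewrite mem_filter => /andP[/asboolP Wb bA]; split=> //.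
  exact: (AP b bA).1.
have : (size A <= count (W 0) A + count (W 1) A + count (W 2) A)%N.
  have cP b : b \in A -> contributes b by move=> /AP[].
  elim: A cP {uA AP le} => [//|b A IH] cP /=.
  have {}IH : (size A <= count (W 0) A + count (W 1) A + count (W 2) A)%N.
    by apply: IH => c cA; apply: cP; rewrite inE cA orbT.
  have : (0 < W 0 b + W 1 b + W 2 b)%N.
    rewrite /=; have [h|h|h] := cP b (mem_head _ _); rewrite (asboolT h);
    by rewrite !addn_gt0 ?orbT.
  by move: IH; rewrite /=; lia.
by move=> h; apply: leq_trans h _; rewrite !leq_add //; apply: le.
Qed.

Lemma principal_divisors_form y :
  principal_divisors S (\row_j dual_form y (v j)).
Proof. by exists (dual_form y). Qed.

Lemma line_bundle_eq r r' : principal_divisors S (r' - r) ->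
  line_bundle S r = line_bundle S r'.
Proof.
move=> [w wE]; apply/seteqP; split=> x [u uE].
  exists (u \- w); apply/rowP => i; have /rowP/(_ i) := uE; have /rowP/(_ i) := wE.
  rewrite !mxE /= => h1 h2; rewrite -h1 -h2; ring.
exists (u \+ w); apply/rowP => i; have /rowP/(_ i) := uE; have /rowP/(_ i) := wE.
rewrite !mxE /= => h1 h2; rewrite -h1 -h2; ring.
Qed.

Definition small m a := exists d0 d1 d2,
  [/\ dim_H S 0 a d0, dim_H S 1 a d1, dim_H S 2 a d2 & (d0 + d1 + d2 < m)%N].

Lemma small_bound p (K m : nat) (i := succ p) (q := succ i) :
  exists F : nat, forall a, small m a ->
    `|a 0 p| <= K%:Z -> `|a 0 i| <= K%:Z -> `|a 0 q| <= F%:Z.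
Proof.
(* The form behind [d] vanishes on [v i] and gives the long translations; the form behind [e] is
   positive on [v i] and gives the short one. *)
pose d j := cross (v j) (v i).
pose e j := dual_form (v i) (v j).
have ei : 0 < e i by exact: dual_form_gt0 (vec_neq0 S i).
have dp : 0 < d p by exact: cross_succ.
have dq : d q < 0 by rewrite /d crossC oppr_lt0; exact: cross_succ.
have di : d i = 0 by rewrite /d /cross; ring.
have d0 j : j != i -> d j != 0 by rewrite /d cross_vec_eq0.
(* No entry changes by more than [E] under the short translation, so entries of absolute value above
   [E] keep their sign. *)
pose E := (\sum_j K.+1 * absz (e j))%N.
have EP j : K.+1%:Z * `|e j| <= E%:Z.
  have : (K.+1 * absz (e j) <= E)%N by rewrite /E (bigD1 j) //= leq_addr.
  by rewrite -lez_nat PoszM abszE.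
(* Among L values of t at most n(2E + 1) are bad, which leaves m good ones. They are taken above K,
   so that the entry at p has the sign of [tau], and up to T, so that the entry at q moves by at
   most [F] and keeps its sign. *)
pose L := (n * E.*2.+1 + m)%N; pose T := (K + L)%N.
pose F := (T * absz (d q))%N.
exists F => a [d0' [d1' [d2' [D0 D1 D2 lt_m]]]] ap ai.
rewrite leNgt; apply/negP => aq.
pose tau : int := if 0 <= a 0 q then 1 else -1.
(* As |a_i| is at most K and e_i is at least 1, adding [eta] times e_i flips the sign at i. *)
pose eta : int := if 0 <= a 0 i then - K.+1%:Z else K.+1%:Z.
pose shift t s : 'rV[int]_n := \row_j (a 0 j + t%:Z * (tau * d j) + s * e j).
have shift_principal t s : principal_divisors S (shift t s - a).
  rewrite (_ : shift t s - a = \row_j dual_form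
    (\row_k (t%:Z * tau * (if k == 0 then v i 0 1 else - v i 0 0) +
             s * v i 0 k)) (v j)).
    exact: principal_divisors_form.
  by apply/rowP => j; rewrite !mxE /dual_form !mxE /= /d /e /cross /dual_form; ring.
pose good t := [forall j, (j != i) ==> (E%:Z < `|a 0 j + t%:Z * (tau * d j)|)].
have flip t : (K < t <= T)%N -> good t ->
    contributes (shift t 0) \/ contributes (shift t eta).
  move=> tT /forallP gt; apply: (sign_flip (p := p)).
  - move=> j ji; have /implyP/(_ ji) := gt j; rewrite !mxE mul0r addr0.
    have := EP j; rewrite /eta; move: (a 0 j + _) (e j) => x y.
    by case: ifP => _; nia.
  - rewrite !mxE di mulr0 mulr0 addr0 mul0r addr0 -/i /eta.
    by move: ai ei; case: (leP 0 (a 0 i)); move: (a 0 i) (e i) => x y; nia.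
  rewrite !mxE !mul0r !addr0 -/i -/q /tau.
  have tF : t%:Z * `|d q| <= F%:Z.
    by rewrite /F PoszM abszE ler_wpM2r // lez_nat; case/andP: tT.
  move: ap aq dp dq tF; case: (leP 0 (a 0 q)).
    by move: (a 0 p) (a 0 q) (d p) (d q); nia.
  by move: (a 0 p) (a 0 q) (d p) (d q); nia.
pose ts := [seq t <- iota K.+1 L | good t].
have ts_size : (m <= size ts)%N.
  rewrite size_filter -(leq_add2l (n * E.*2.+1)) -[X in (X <= _)%N](size_iota K.+1).
  apply: count_avoid (iota_uniq _ _) => j /d0 dj.
  by rewrite mulf_neq0 // /tau; case: ifP.
have ts_flip t : t \in ts ->
    contributes (shift t 0) \/ contributes (shift t eta).
  rewrite mem_filter mem_iota => /andP[gt tK]; apply: flip gt.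
  by rewrite /T; lia.
have /choice[s sP] t : exists s : int, t \in ts -> contributes (shift t s).
  have [tt|_] := boolP (t \in ts); last by exists 0.
  by have [h|h] := ts_flip t tt; [exists 0|exists eta].
pose A := [seq shift t (s t) | t <- ts].
(* The entry at i determines s, because d_i = 0 and e_i > 0; the entry at p then determines t. *)
have uA : uniq A.
  rewrite map_inj_in_uniq ?filter_uniq ?iota_uniq // => t t' _ _ /rowP E'.
  have := E' i; have := E' p; rewrite !mxE di !mulr0 !addr0 => Ep /addrI Ei.
  have st : s t = s t' by apply: (mulIf (lt0r_neq0 ei)).
  move: Ep; rewrite st => /addIr /addrI; move/mulIf => h.
  have : tau * d p != 0.
    by rewrite mulf_neq0 ?(lt0r_neq0 dp) // /tau; case: ifP.
  by move=> /h [].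
have := contributes_count uA _ D0 D1 D2.
have AP b : b \in A -> principal_divisors S (b - a) /\ contributes b.
  move=> /mapP[t tt ->]; split; first exact: shift_principal.
  exact: sP.
move=> /(_ AP); rewrite size_map => h.
by move: (leq_trans ts_size h); rewrite leqNgt lt_m.
Qed.

(** * Going round the fan, and finiteness *)

Lemma small_bounded i (K m : nat) : exists F : nat, forall a, small m a ->
  `|a 0 i| <= K%:Z -> `|a 0 (succ i)| <= K%:Z -> forall j, `|a 0 j| <= F%:Z.
Proof.
have iterP k : exists F : nat, forall a, small m a ->
    `|a 0 i| <= K%:Z -> `|a 0 (succ i)| <= K%:Z ->
    `|a 0 (iter k succ i)| <= F%:Z /\ `|a 0 (iter k.+1 succ i)| <= F%:Z.
  elim: k => [|k [F FP]]; first by exists K.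
  have [F' F'P] := small_bound (iter k succ i) F m.
  exists (F + F')%N => a sa a1 a2; have [h1 h2] := FP a sa a1 a2.
  have := F'P a sa h1 h2; rewrite -!iterS => h3.
  by split; [apply: le_trans h2 _|apply: le_trans h3 _];
     rewrite lez_nat ?leq_addr ?leq_addl.
have /choice[F FP] j : exists F : nat, forall a, small m a ->
    `|a 0 i| <= K%:Z -> `|a 0 (succ i)| <= K%:Z -> `|a 0 j| <= F%:Z.
  have [F FP] := iterP (findex succ i j); exists F => a sa a1 a2.
  have [+ _] := FP a sa a1 a2; rewrite iter_findex //; exact: succ_orbit.
exists (\sum_j F j)%N => a sa a1 a2 j; apply: le_trans (FP j a sa a1 a2) _.
by rewrite lez_nat (bigD1 j) //= leq_addr.
Qed.

(** Forms with values al D on [v i] and be D on [v (succ i)] exist for all integers al and be, so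
    both entries can be replaced by their remainders modulo D. *)
Lemma normalized_representative i r : exists2 a, principal_divisors S (a - r) &
  let D := absz (cross (v i) (v (succ i))) in
  `|a 0 i| <= D%:Z /\ `|a 0 (succ i)| <= D%:Z.
Proof.
set D := cross _ _; have D0 : 0 < D := cross_succ _ i.
pose al := - (r 0%R i %/ D)%Z; pose be := - (r 0%R (succ i) %/ D)%Z.
pose y : lattice := \row_k (if k == 0 then al * v (succ i) 0 1 - be * v i 0 1
                            else be * v i 0 0 - al * v (succ i) 0 0).
exists (r + \row_j dual_form y (v j)).
  by rewrite addrC addKr; exact: principal_divisors_form.
have modE (x : int) : `|x - (x %/ D)%Z * D| <= (absz D)%:Z.
  have := divz_eq x D; have := modz_ge0 x (lt0r_neq0 D0); have := ltz_pmod x D0.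
  by move: (_ * D) => ?; lia.
rewrite /=; split; rewrite !mxE /dual_form !mxE /=.
  rewrite (_ : _ + _ = r 0 i - (r 0%R i %/ D)%Z * D) ?modE //.
  by rewrite /al /be; move: (divz _ _) (divz _ _) => q1 q2; rewrite /D /cross; ring.
rewrite (_ : _ + _ = r 0 (succ i) - (r 0%R (succ i) %/ D)%Z * D) ?modE //.
by rewrite /al /be; move: (divz _ _) (divz _ _) => q1 q2; rewrite /D /cross; ring.
Qed.

Lemma finite_box (k : nat) :
  finite_set [set a : 'rV[int]_n | forall j, `|a 0 j| <= k%:Z].
Proof.
apply: (@sub_finite_set _ _ [set (\row_j ((f j)%:Z - k%:Z) : 'rV[int]_n) |
  f in [set: {ffun 'I_n -> 'I_k.*2.+1}]]); last first.
  by apply: finite_image; exact: finite_finset.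
move=> a ak; exists [ffun j => inord (absz (a 0 j + k%:Z))] => //.
apply/rowP => j; rewrite !mxE ffunE inordK; have := ak j; lia.
Qed.

Lemma Lambda_bounded m : exists K : nat,
  forall L, Lambda S m L -> exists2 a : 'rV[int]_n, (forall j, `|a 0 j| <= K%:Z) &
    L = line_bundle S a.
Proof.
(* Without rays the bound on entries is vacuous. *)
have [[i _]|none] := pselect (exists i : 'I_n, True); last first.
  by exists 0%N => L [_ [r -> _]]; exists r => // j; case: none; exists j.
have [K KP] := small_bounded i (absz (cross (v i) (v (succ i)))) m.
exists K => L [_ [r -> [d0 [d1 [d2 [D0 D1 D2 lt_m]]]]]].
have [a /line_bundle_eq ra [a1 a2]] := normalized_representative i r.
exists a; last by [].
by apply: KP => //; exists d0, d1, d2; split=> //; apply: dim_H_line_bundle ra _.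
Qed.

End Bound.

Theorem theorem5p1 (R : realType) (n : nat) (S : stacky_fan R n) :
  (forall i j : 'I_n, i != j -> ~ collinear R (vec S i) (vec S j)) ->
  forall m : nat, (0 < m)%N -> finite_set (Lambda S m).
Proof.
move=> nc m _; have [K KP] := Lambda_bounded nc m.
apply: (@sub_finite_set _ _
  [set line_bundle S a | a in [set a : 'rV[int]_n | forall j, `|a 0 j| <= K%:Z]]).
  by move=> L /KP[a aK ->]; exists a.
by apply: finite_image; exact: finite_box.
Qed.
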